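(* Let $X = X^n$ be a smooth, complete, connected submanifold of dimension $n$ and of constant rank $r$, $2 \leq r \leq n-1$, in a complex affine space $A^N(\mathbb{C})$ with $N - n \geq 2$. Suppose that in the pencil of the second fundamental forms of $X$ there are two forms $\phi'$ and $\phi''$ defining a regular pencil all of whose eigenvalues are distinct. Then $X$ is a cylinder with $l$-dimensional plane generators, $l = n - r \geq 1$, and with an $r$-dimensional tangentially nondegenerate director variety $Y$. In $A^N(\mathbb{C})$ such a cylinder can be defined by a parametric equation $$\vec{\phi}(y^1,\ldots,y^n) = \sum_{j=1}^{l} \vec{a}_j\, y^j + \vec{b}(y^{l+1},\ldots,y^n),$$ where $\vec{a}_1,\ldots,\vec{a}_l$ are constant vectors in $A^N(\mathbb{C})$, $\vec{b}$ is a vector-valued function of $r = n-l$ variables defining the director variety $Y$ in $A^N(\mathbb{C})$, and the vectors $\vec{a}_j$ ($j=1,\ldots,l$) and $\vec{b}_p = \partial \vec{b}/\partial y^p$ ($p=l+1,\ldots,n$) are linearly independent.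
   Context: Rank and generators. Regard $A^N(\mathbb{C})$ as the complement of a hyperplane at infinity $P^{N-1}_\infty$ in $P^N(\mathbb{C})$. The Gauss map $\gamma$ of an $n$-dimensional submanifold $X$ sends $x\in X$ to its tangent subspace $T_x(X)$, considered as an $n$-dimensional projective subspace $P^n(\mathbb{C})$. The rank $r$ of $X$ is the rank of $\gamma$; it is assumed constant on $X$. $X$ is tangentially degenerate if $r<n$, and tangentially nondegenerate if its rank equals its dimension. When $r<n$, the leaves of $\gamma$ (sets $\gamma^{-1}(T_x)$) are projective subspaces of dimension $l=n-r$ or open parts of them. The leaves are extended to full $l$-dimensional projective subspaces $L\cong P^l(\mathbb{C})$, called plane generators. Thus $X=f(P^l(\mathbb{C})\times M^r)$, where $M^r$ is an $r$-dimensional complex variety of parameters and $f: P^l(\mathbb{C})\times M^r\to P^N(\mathbb{C})$ is a differentiable map; in this sense $X$ is complete. $T_L$ denotes the common $n$-dimensional tangent subspace to $X$ along the generator $L$. Regular and singular points. Smooth means differentiable (hence complex-analytic) and without singular points in the affine space: a point $x$ of a generator $L$ is regular if $T_x=T_L$, and singular if $T_x$ is a proper subspace of $T_L$, where $T_x$ is the tangent subspace obtained as the span of $L$ and the first-order displacements of $x$ under $f$. All singular points of $X$ are thus located in $P^{N-1}_\infty$. Second fundamental forms. Use projective frames $\{A_0,\ldots,A_N\}$ adapted to $X$, with $dA_u=\omega_u^vA_v$, the points $A_0,\ldots,A_l$ spanning $L$, the points $A_0,\ldots,A_n$ spanning $T_L$, and $A_0$ a regular point of $L$. Then $\omega_0^p$,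 $p=l+1,\ldots,n$, are basis forms on $M^r$, and $\omega_p^\alpha=b^\alpha_{pq}\omega_0^q$ with $b^\alpha_{pq}=b^\alpha_{qp}$, $\alpha=n+1,\ldots,N$. The second fundamental forms of $X$ at $A_0$ are $\phi^\alpha=b^\alpha_{pq}\omega_0^p\omega_0^q$, and the pencil of second fundamental forms consists of all linear combinations $\xi_\alpha\phi^\alpha$ (summation over repeated indices). Eigenvalues. For two forms $\phi'=b'_{pq}\theta^p\theta^q$ and $\phi''=b''_{pq}\theta^p\theta^q$, the pencil they span is regular if $\det(b''_{pq}+\lambda b'_{pq})$ is not identically zero in $\lambda$. Its $r$ eigenvalues are the roots of the characteristic equation $\det(b''_{pq}+\lambda b'_{pq})=0$. The hypothesis on the pencil is a condition on $X$ along each of its generators. Cylinder. An $l$-cylinder in an affine space $A^N$ is a smooth $n$-dimensional submanifold bearing $l$-dimensional plane generators, $l<n$, which are parallel one to another. Its director variety is an $r$-dimensional submanifold, $r = n-l$, over which it is erected. *)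

(* Defs.v *)
From HB Require Import structures.
From mathcomp Require Import all_boot all_order all_algebra.
From mathcomp Require Import complex.
From mathcomp Require Import boolp classical_sets functions cardinality reals.
From mathcomp Require Import topology normedtype derive.

Set Implicit Arguments.
Unset Strict Implicit.
Unset Printing Implicit Defensive.
Import Order.TTheory GRing.Theory Num.Theory.
Import numFieldNormedType.Exports.
Local Open Scope classical_set_scope.
Local Open Scope ring_scope.

(* K is the field of scalars, later the complex numbers R[i] over a realType. *)

Definition partial (K : numFieldType) (r k m : nat) (p : 'I_r)
    (g : 'rV[K]_r -> 'M[K]_(k, m)) (u : 'rV[K]_r) : 'M[K]_(k, m) :=
  'D_(delta_mx 0 p) g u.

(* Over the complex numbers one derivative on an open set already gives       *)
(* all of them (Goursat); differentiability of every order is made part of    *)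
(* the definition because the library has no Cauchy theory.                   *)
Fixpoint differentiable_upto (K : numFieldType) (r k m d : nat)
    (U : set 'rV[K]_r) (g : 'rV[K]_r -> 'M[K]_(k, m)) : Prop :=
  (forall u, U u -> differentiable g u) /\
  (if d is d'.+1 then forall p, differentiable_upto d' U (partial p g)
   else True).

Definition holomorphic (K : numFieldType) (r k m : nat)
    (U : set 'rV[K]_r) (g : 'rV[K]_r -> 'M[K]_(k, m)) : Prop :=
  forall d, differentiable_upto d U g.

(* Only the values of chart_map on chart_dom and of chart_inv on chart_cod    *)
(* are meaningful.                                                            *)
Record chart (K : numFieldType) (M : topologicalType) (r : nat) := Chart {
  chart_dom : set M;
  chart_map : M -> 'rV[K]_r;
  chart_inv : 'rV[K]_r -> M }.

Definition chart_cod (K : numFieldType) (M : topologicalType) (r : nat)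
    (c : chart K M r) : set 'rV[K]_r := chart_map c @` chart_dom c.

Definition is_chart (K : numFieldType) (M : topologicalType) (r : nat)
    (c : chart K M r) : Prop :=
  [/\ open (chart_dom c) /\ open (chart_cod c),
      {within chart_dom c, continuous (chart_map c)},
      {within chart_cod c, continuous (chart_inv c)} &
      forall x, chart_dom c x -> chart_inv c (chart_map c x) = x].

Definition complex_manifold (K : numFieldType) (M : topologicalType) (r : nat)
    (atlas : set (chart K M r)) : Prop :=
  [/\ hausdorff_space M,
      @second_countable M,
      forall c, atlas c -> is_chart c,
      forall x, exists2 c, atlas c & chart_dom c x &
      forall c c', atlas c -> atlas c' ->
        holomorphic (chart_cod c `&` chart_inv c @^-1` chart_dom c')
          (chart_map c' \o chart_inv c)].

(* Points and subspaces of P^N are given by homogeneous coordinates, as row   *)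
(* spaces of matrices with N.+1 columns.  The hyperplane at infinity is the   *)
(* vanishing of the coordinate of index 0.                                    *)
Definition homog (K : numFieldType) (N : nat) (x : 'rV[K]_N) : 'rV[K]_N.+1 :=
  row_mx (1%:M : 'M[K]_1) x.

Definition at_infinity (K : numFieldType) (N : nat) (x : 'rV[K]_N.+1) : Prop :=
  x 0 0 = 0.

(* A map f : P^l x M -> P^N carrying each P^l x {m} isomorphically onto an    *)
(* l-dimensional projective subspace is given by a matrix f m, defined up to  *)
(* a nonzero factor: the image of ([s], m) is [s *m f m] and the generator    *)
(* L is the row space of f m.  It is only up to this factor that f m depends  *)
(* holomorphically on m: a lift of f in the chart c is a holomorphic choice   *)
(* of the factor on an open set of coordinates.                               *)
Definition is_lift (K : numFieldType) (M : topologicalType) (r k N : nat)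
    (f : M -> 'M[K]_(k, N.+1)) (c : chart K M r) (U : set 'rV[K]_r)
    (A : 'rV[K]_r -> 'M[K]_(k, N.+1)) : Prop :=
  [/\ open U, U `<=` chart_cod c, holomorphic U A &
      forall u, U u -> exists2 a : K, a != 0 & A u = a *: f (chart_inv c u)].

(* The complete submanifolds f(P^l x M) whose generators are not contained in *)
(* the hyperplane at infinity.                                                *)
Definition complete (K : numFieldType) (M : topologicalType) (r l N : nat)
    (atlas : set (chart K M r)) (f : M -> 'M[K]_(l.+1, N.+1)) : Prop :=
  [/\ forall m, row_free (f m),
      forall m, exists s, ~ at_infinity (s *m f m) &
      forall c, atlas c -> forall u, chart_cod c u ->
        exists U A, is_lift f c U A /\ U u].

(* Affine part of a generator and of the whole submanifold. *)
Definition generator (K : numFieldType) (M : Type) (k N : nat)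
    (f : M -> 'M[K]_(k, N.+1)) (m : M) : set 'rV[K]_N :=
  [set x | (homog x <= f m)%MS].

Definition affine_part (K : numFieldType) (M : Type) (k N : nat)
    (f : M -> 'M[K]_(k, N.+1)) : set 'rV[K]_N :=
  \bigcup_m generator f m.

(* The tangent subspace T_x at x = [s *m A u]: the span of L and of the       *)
(* first-order displacements of x.                                            *)
Definition tangent (K : numFieldType) (r k N : nat)
    (A : 'rV[K]_r -> 'M[K]_(k, N.+1)) (u : 'rV[K]_r) (s : 'rV[K]_k) :
    'M[K]_(k + r, N.+1) :=
  col_mx (A u) (\matrix_(p < r) (s *m partial p A u)).

(* The span T_L of the T_x for all x in L; it is the common value of T_x at   *)
(* the regular points.                                                        *)
Definition tangent_along (K : numFieldType) (r k N : nat)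
    (A : 'rV[K]_r -> 'M[K]_(k, N.+1)) (u : 'rV[K]_r) : 'M[K]_N.+1 :=
  (A u + \sum_(p < r) <<partial p A u>>)%MS.

Definition regular_point (K : numFieldType) (r k N : nat)
    (A : 'rV[K]_r -> 'M[K]_(k, N.+1)) (u : 'rV[K]_r) (s : 'rV[K]_k) : Prop :=
  (tangent A u s == tangent_along A u)%MS.

Definition smooth_submanifold (K : numFieldType) (M : topologicalType)
    (n r l N : nat) (atlas : set (chart K M r))
    (f : M -> 'M[K]_(l.+1, N.+1)) : Prop :=
  forall c U A, atlas c -> is_lift f c U A -> forall u, U u ->
    \rank (tangent_along A u) = n.+1 /\
    forall s, ~ at_infinity (s *m A u) -> regular_point A u s.

(* Rank at z of the map to a Grassmannian sending z to the row space of G z,  *)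
(* for G z of full row rank: the tangent space of the Grassmannian at a       *)
(* subspace T of V is Hom(T, V / T), and the differential is dG modulo G.     *)
Definition grassmann_rank (K : numFieldType) (d k m : nat)
    (G : 'rV[K]_d -> 'M[K]_(k, m)) (z : 'rV[K]_d) : nat :=
  \rank (lin1_mx (fun v => mxvec ('D_v G z *m cokermx (G z)))).

(* Rank of the Gauss map x |-> T_x at x = [s *m A u], where x is parametrized *)
(* by s and u jointly.                                                        *)
Definition gauss_rank (K : numFieldType) (r k N : nat)
    (A : 'rV[K]_r -> 'M[K]_(k, N.+1)) (u : 'rV[K]_r) (s : 'rV[K]_k) : nat :=
  grassmann_rank (fun z : 'rV[K]_(k + r) => tangent A (rsubmx z) (lsubmx z))
    (row_mx s u).

Definition constant_rank (K : numFieldType) (M : topologicalType)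
    (r l N : nat) (atlas : set (chart K M r))
    (f : M -> 'M[K]_(l.+1, N.+1)) : Prop :=
  forall c U A, atlas c -> is_lift f c U A -> forall u, U u ->
    forall s, ~ at_infinity (s *m A u) -> gauss_rank A u s = r.

(* Moving frames: the rows of E u are A_0, ..., A_N. *)
Definition adapted_frame (K : numFieldType) (r l n N : nat)
    (A : 'rV[K]_r -> 'M[K]_(l.+1, N.+1)) (U : set 'rV[K]_r)
    (E : 'rV[K]_r -> 'M[K]_N.+1) : Prop :=
  holomorphic U E /\
  forall u, U u ->
    [/\ E u \in unitmx,
        (\sum_(i < N.+1 | (i <= l)%N) <<row i (E u)>> == A u)%MS,
        (\sum_(i < N.+1 | (i <= n)%N) <<row i (E u)>> == tangent_along A u)%MS &
        exists2 s, row 0 (E u) = s *m A u & regular_point A u s].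

(* The entry (i, j) is the value at v of the form omega_i^j in                *)
(* dA_i = omega_i^j A_j.                                                      *)
Definition frame_form (K : numFieldType) (r N : nat)
    (E : 'rV[K]_r -> 'M[K]_N.+1) (u v : 'rV[K]_r) : 'M[K]_N.+1 :=
  'D_v E u *m invmx (E u).

(* b alpha is the matrix of phi^alpha in the basis omega_0^p; p : 'I_r stands *)
(* for the index l + 1 + p, and only the alpha > n are relevant.              *)
Definition second_fundamental_forms (K : numFieldType) (r l n N : nat)
    (E : 'rV[K]_r -> 'M[K]_N.+1) (u : 'rV[K]_r)
    (b : 'I_N.+1 -> 'M[K]_r) : Prop :=
  forall alpha : 'I_N.+1, (n < alpha)%N ->
    (b alpha)^T = b alpha /\
    forall (v : 'rV[K]_r) (p : 'I_r),
      frame_form E u v (inord (l.+1 + p)) alpha =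
      \sum_(q < r) b alpha p q * frame_form E u v 0 (inord (l.+1 + q)).

Definition pencil_form (K : numFieldType) (r n N : nat)
    (b : 'I_N.+1 -> 'M[K]_r) (xi : 'I_N.+1 -> K) : 'M[K]_r :=
  \sum_(alpha < N.+1 | (n < alpha)%N) xi alpha *: b alpha.

(* det (B2 + lambda B1) as a polynomial in lambda. *)
Definition pencil_char_poly (K : numFieldType) (r : nat) (B1 B2 : 'M[K]_r) :
    {poly K} :=
  \det (map_mx polyC B2 + 'X *: map_mx polyC B1).

Definition regular_pencil (K : numFieldType) (r : nat) (B1 B2 : 'M[K]_r) :
    Prop :=
  pencil_char_poly B1 B2 != 0.

Definition distinct_eigenvalues (K : numFieldType) (r : nat)
    (B1 B2 : 'M[K]_r) : Prop :=
  exists e : seq K,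
    [/\ size e = r, uniq e & all (root (pencil_char_poly B1 B2)) e].

Definition regular_pencil_along_generators (K : numFieldType)
    (M : topologicalType) (n r l N : nat) (atlas : set (chart K M r))
    (f : M -> 'M[K]_(l.+1, N.+1)) : Prop :=
  forall c U A, atlas c -> is_lift f c U A -> forall u, U u ->
    exists U' E b xi1 xi2,
      [/\ [/\ open U', U' `<=` U & U' u],
          adapted_frame n A U' E,
          second_fundamental_forms l n E u b,
          regular_pencil (pencil_form n b xi1) (pencil_form n b xi2) &
          distinct_eigenvalues (pencil_form n b xi1) (pencil_form n b xi2)].

Definition cylinder_map (K : numFieldType) (l r N : nat)
    (a : 'I_l -> 'rV[K]_N) (b : 'rV[K]_r -> 'rV[K]_N) (y : 'rV[K]_(l + r)) :
    'rV[K]_N :=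
  \sum_(j < l) lsubmx y 0 j *: a j + b (rsubmx y).

(* The vectors a_j and the partial derivatives of b are independent. *)
Definition cylinder_independent (K : numFieldType) (l r N : nat)
    (a : 'I_l -> 'rV[K]_N) (b : 'rV[K]_r -> 'rV[K]_N) (u : 'rV[K]_r) : Prop :=
  row_free (col_mx (\matrix_(j < l) a j) (\matrix_(p < r) partial p b u)).

(* An r-dimensional submanifold of the affine space parametrized by b is the  *)
(* case of zero-dimensional generators, with lift homog \o b.                 *)
Definition tangentially_nondegenerate (K : numFieldType) (r N : nat)
    (b : 'rV[K]_r -> 'rV[K]_N) (u : 'rV[K]_r) : Prop :=
  gauss_rank (fun w => homog (b w)) u (1%:M : 'rV[K]_1) = r.

(* Main.v *)
Require Import Defs.
From HB Require Import structures.
From mathcomp Require Import all_boot all_order all_algebra.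
From mathcomp Require Import complex.
From mathcomp Require Import boolp classical_sets functions cardinality reals.
From mathcomp Require Import topology normedtype landau derive.
From mathcomp Require Import ring.

(* Write L for a generator, spanned by the rows of a lift A, and T for the
   tangent space along L.  Regularity of all the affine points of L says that
   for s at infinity the displacements of s, expressed modulo A through those of
   an affine point, form a matrix C such that C + a is invertible for all
   nonzero a.  Since T is constant along L, C is self-adjoint for every second
   fundamental form, and two forms generating a regular pencil with distinct
   eigenvalues diagonalize C simultaneously; hence C = 0.  So the intersection
   of L with the hyperplane at infinity has zero derivative: it is locally
   constant, hence constant as M is connected, and the generators are parallel.
   Projecting along their common direction gives the director variety, whose
   Gauss map has the rank of that of X. *)

Set Implicit Arguments.
Unset Strict Implicit.
Unset Printing Implicit Defensive.
Import Order.TTheory GRing.Theory Num.Theory.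
Import numFieldNormedType.Exports.
Local Open Scope classical_set_scope.
Local Open Scope ring_scope.

(** * Calculus of matrix-valued functions *)

(** For [s] at infinity and [s0] affine, the point [s + a s0] is affine as soon as [a] is not 0; its
    regularity is what makes [C + a] invertible. So [C] can have no eigenvalue but 0, which alone
    would only make it nilpotent; the simple spectrum of the pencil is there to make it
    diagonalizable as well. Self-adjointness comes from the equality of mixed second derivatives of
    a lift, tested against covectors that annihilate the tangent space. That equality is reduced to
    the real mean value theorem, applied to real parts along real segments. Generators are row
    spaces and lifts are defined up to a factor, so a subspace cannot be differentiated directly.
    Statements are therefore phrased as memberships in row spaces, or a lift is first normalized
    against a constant matrix. *)

Section MatrixCalculus.
Variables (K : numFieldType) (V : normedModType K).

Lemma differentiable_mx_entry m n (f : V -> 'M[K]_(m, n)) x i j :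
  differentiable f x -> differentiable (fun y => f y i j) x.
Proof.
move=> df; apply: (@differentiable_comp _ _ _ _ f (fun M : 'M[K]_(m, n) =>
  M i j)) => //.
exact: differentiable_coord.
Qed.

Lemma derive_mx_entry m n (f : V -> 'M[K]_(m, n)) x v i j :
  differentiable f x -> ('D_v f x) i j = 'D_v (fun y => f y i j) x.
Proof.
move=> df; rewrite (deriveE _ df) deriveE; last exact: differentiable_mx_entry.
have @c : {linear 'M[K]_(m, n) -> K}.
  by exists (fun N : 'M[K]_(_, _) => N i j); do 2![eexists]; do ?[constructor];
     rewrite ?mxE// => ? *; rewrite ?mxE//; move=> ?; rewrite !mxE.
have cc : continuous c by exact: coord_continuous.
have dc y : differentiable c y by exact: linear_differentiable.
have /(congr1 (fun h => h v)) := diff_comp df (dc (f x)).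
by rewrite diff_lin //= => <-.
Qed.

Lemma differentiable_mx m n (f : V -> 'M[K]_(m, n)) x :
  (forall i j, differentiable (fun y => f y i j) x) -> differentiable f x.
Proof.
move=> df.
have -> : f = (fun y => \sum_i \sum_j f y i j *: delta_mx i j).
  by apply/funext => y; exact: matrix_sum_delta.
have -> : (fun y => \sum_i \sum_j f y i j *: delta_mx i j) =
   \sum_i \sum_j (fun y => f y i j *: delta_mx i j : 'M[K]_(m, n)).
  apply/funext => y; rewrite fct_sumE; apply: eq_bigr => i _.
  by rewrite fct_sumE.
by apply: differentiable_sum => i; apply: differentiable_sum => j;
  apply: differentiableZl.
Qed.

Lemma derive_sumf (I : finType) (f : I -> V -> K) x v :
  (forall i, differentiable (f i) x) ->
  'D_v (fun y => \sum_i f i y) x = \sum_i 'D_v (f i) x /\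
  differentiable (fun y => \sum_i f i y) x.
Proof.
move=> df.
have E J : (fun y => \sum_(i <- J) f i y) = \sum_(i <- J) f i.
  by apply/funext => y; rewrite fct_sumE.
rewrite E.
apply: (big_rec2 (fun z (y : V -> K) => 'D_v y x = z /\ differentiable y x)) =>
  [|i y1 y2 _ [<- d2]]; first by split;
  [exact: derive_cst|exact: differentiable_cst].
by split; [rewrite deriveD //; exact: diff_derivable|exact: differentiableD].
Qed.

Lemma differentiable_mulmx m n p (f : V -> 'M[K]_(m, n)) (g : V -> 'M[K]_(n, p))
  x :
  differentiable f x -> differentiable g x -> differentiable
    (fun y => f y *m g y) x.
Proof.
move=> df dg; apply: differentiable_mx => i j.
under eq_fun do rewrite mxE.
apply: (proj2 (@derive_sumf _ (fun k y => f y i k * g y k j) x 0 _)) => k.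
by apply: differentiableM; exact: differentiable_mx_entry.
Qed.

Lemma derive_mulmx m n p (f : V -> 'M[K]_(m, n)) (g : V -> 'M[K]_(n, p)) x v :
  differentiable f x -> differentiable g x ->
  'D_v (fun y => f y *m g y) x = 'D_v f x *m g x + f x *m 'D_v g x.
Proof.
move=> df dg; apply/matrixP => i j.
rewrite derive_mx_entry; last exact: differentiable_mulmx.
under eq_fun do rewrite mxE.
rewrite (proj1 (@derive_sumf _ (fun k y => f y i k * g y k j) x v _));
  last first.
  by move=> k; apply: differentiableM; exact: differentiable_mx_entry.
rewrite !mxE -big_split; apply: eq_bigr => k _ /=.
rewrite deriveM; try by apply/diff_derivable/differentiable_mx_entry.
rewrite !derive_mx_entry // addrC; congr (_ + _); exact: mulrC.
Qed.

Lemma differentiable_mulmxl m n p (C : 'M[K]_(m, n)) (g : V -> 'M[K]_(n, p)) x :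
  differentiable g x -> differentiable (fun y => C *m g y) x.
Proof. by apply: differentiable_mulmx; exact: differentiable_cst. Qed.

Lemma differentiable_mulmxr m n p (f : V -> 'M[K]_(m, n)) (C : 'M[K]_(n, p)) x :
  differentiable f x -> differentiable (fun y => f y *m C) x.
Proof. by move=> df; apply: differentiable_mulmx => //;
  exact: differentiable_cst. Qed.

Lemma derive_mulmxl m n p (C : 'M[K]_(m, n)) (g : V -> 'M[K]_(n, p)) x v :
  differentiable g x -> 'D_v (fun y => C *m g y) x = C *m 'D_v g x.
Proof.
move=> dg; rewrite (derive_mulmx v (differentiable_cst _ _) dg).
by rewrite [X in X *m _]derive_cst mul0mx add0r.
Qed.

Lemma derive_mulmxr m n p (f : V -> 'M[K]_(m, n)) (C : 'M[K]_(n, p)) x v :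
  differentiable f x -> 'D_v (fun y => f y *m C) x = 'D_v f x *m C.
Proof.
move=> df; rewrite (derive_mulmx v df (differentiable_cst _ _)).
by rewrite [X in _ + _ *m X]derive_cst mulmx0 addr0.
Qed.

End MatrixCalculus.

Section LocalDerivative.
Variables (K : numFieldType) (V W : normedModType K).

Lemma near_open (U : set V) (f g : V -> W) x : open U -> U x ->
  (forall y, U y -> f y = g y) -> \near x, f x = g x.
Proof. by move=> oU Ux fg; apply: filterS (open_nbhs_nbhs (conj oU Ux)). Qed.

Lemma derive_congr_open (U : set V) (f g : V -> W) x v : open U -> U x ->
  (forall y, U y -> f y = g y) -> 'D_v f x = 'D_v g x.
Proof. by move=> oU Ux fg; apply: near_eq_derive; exact: near_open oU Ux
  fg. Qed.

(** The first-order expansion of [f] at [x] is also one of [g], and uniqueness of the differential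
    identifies ['d g x] with ['d f x]. *)
Lemma differentiable_congr_open (U : set V) (f g : V -> W) x : open U -> U x ->
  (forall y, U y -> f y = g y) -> differentiable f x -> differentiable g x.
Proof.
move=> oU Ux fg df; have gx := fg _ Ux.
have E : g \o shift x = cst (g x) + 'd f x +o_ 0 id.
  apply/eqaddoP => e e0.
  have /eqaddoP /(_ e e0) := diff_locally df.
  have : \forall h \near (0 : V), f (h + x) = g (h + x).
    have := near_open oU Ux fg.
    by rewrite (near_shift 0) subr0.
  apply: filterS2 => h fgh; rewrite -gx /=.
  by rewrite -![(_ + _ : _ -> _) _]/(_ + _) -![(- _ : _ -> _) _]/(- _) /= fgh.
apply/diff_locallyP; rewrite (diff_unique (diff_continuous df) E).
by split => //; exact: diff_continuous.
Qed.
End LocalDerivative.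

(** * Scalar functions differentiable to a given order *)

Section SmoothFunctions.
Variables (K : numFieldType) (r : nat).
Implicit Types (U : set 'rV[K]_r) (f g : 'rV[K]_r -> K).

(** Scalar counterpart of [differentiable_upto]: products, inverses and determinants are handled
    entry by entry, and [differentiable_uptoP] transfers the results to matrices. *)
Fixpoint smooth_upto d U g : Prop :=
  (forall u, U u -> differentiable g u) /\
  (if d is d'.+1 then
     forall p, smooth_upto d' U (fun u => 'D_(delta_mx 0 p) g u)
   else True).

Lemma smooth_differentiable d U g u : smooth_upto d U g -> U u -> differentiable
  g u.
Proof. by case: d => [|d] [dg _]; exact: dg. Qed.

Lemma smooth_ext d U f g : open U -> (forall u, U u -> f u = g u) ->
  smooth_upto d U f -> smooth_upto d U g.
Proof.
move=> oU; elim: d f g => [|d IH] f g fg /= [df sf].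
  by split=> // u Uu; exact: differentiable_congr_open oU Uu fg (df _ Uu).
split=> [u Uu|p]; first exact: differentiable_congr_open oU Uu fg (df _ Uu).
by apply: (IH _ _ _ (sf p)) => u Uu; exact: derive_congr_open oU Uu fg.
Qed.

Lemma smooth_weaken d U f : smooth_upto d.+1 U f -> smooth_upto d U f.
Proof.
elim: d f => [|d IH] f /= [df sf]; split => // p.
exact: IH (sf p).
Qed.

Lemma smooth_subset d U U' f : U' `<=` U -> smooth_upto d U f -> smooth_upto d
  U' f.
Proof.
move=> UU; elim: d f => [|d IH] f /= [df sf];
  (split => [u /UU|]; first exact: df) => // p.
exact: IH (sf p).
Qed.

Lemma smooth_cst d U (a : K) : open U -> smooth_upto d U (fun=> a).
Proof.
move=> oU; elim: d a => [|d IH] a /=; split => // p.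
by apply: smooth_ext (IH 0) => // u _; rewrite derive_cst.
Qed.

Lemma smooth_add d U f g : open U -> smooth_upto d U f -> smooth_upto d U g ->
  smooth_upto d U (fun u => f u + g u).
Proof.
move=> oU; elim: d f g => [|d IH] f g /= [df sf] [dg sg];
  (split => [u Uu|]; first exact: differentiableD (df _ Uu) (dg _ Uu)) => // p.
apply: smooth_ext (IH _ _ (sf p) (sg p)) => // u Uu.
by rewrite deriveD //; apply: diff_derivable; [exact: df|exact: dg].
Qed.

(** The Leibniz rule brings back [f] and [g] themselves, at the lower order; this is what
    [smooth_weaken] supplies. *)
Lemma smooth_mul d U f g : open U -> smooth_upto d U f -> smooth_upto d U g ->
  smooth_upto d U (fun u => f u * g u).
Proof.
move=> oU; elim: d f g => [|d IH] f g; first by move=> /= [df _] [dg _];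
  split => // u Uu;
  exact: differentiableM (df _ Uu) (dg _ Uu).
move=> sf sg; split => [u Uu|p].
  by apply: differentiableM; apply: smooth_differentiable Uu;
    [exact: sf|exact: sg].
have [[df sfp] [dg sgp]] := (sf, sg).
apply: smooth_ext (smooth_add oU (IH _ _ (smooth_weaken sf) (sgp p))
  (IH _ _ (smooth_weaken sg) (sfp p))) => // u Uu.
by rewrite deriveM //; apply: diff_derivable; [exact: df|exact: dg].
Qed.

Lemma smooth_inv d U f : open U -> (forall u, U u -> f u != 0) -> smooth_upto d
  U f ->
  smooth_upto d U (fun u => (f u)^-1).
Proof.
move=> oU f0; elim: d => [|d IH].
  by move=> /= [df _]; split => // u Uu; exact: differentiableV (df _ Uu)
    (f0 _ Uu).
move=> sf; have [df sfp] := sf.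
split => [u Uu|p]; first exact: differentiableV (df _ Uu) (f0 _ Uu).
have sV := IH (smooth_weaken sf).
have := smooth_mul oU (smooth_mul oU sV sV)
  (smooth_mul oU (smooth_cst d (-1) oU) (sfp p)).
apply: smooth_ext => // u Uu.
rewrite deriveV; [|exact: f0|by apply: diff_derivable; exact: df].
by rewrite /GRing.scale /= mulN1r mulrN -expr2 exprVn mulNr.
Qed.

Lemma smooth_sum (I : Type) (J : seq I) (P : pred I) d U (f : I -> 'rV[K]_r ->
  K) : open U ->
  (forall i, P i -> smooth_upto d U (f i)) -> smooth_upto d U
    (fun u => \sum_(i <- J | P i) f i u).
Proof.
move=> oU sf; elim: J => [|i J IH].
  by apply: smooth_ext (smooth_cst d 0 oU) => // u _; rewrite big_nil.
case Pi: (P i).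
  by apply: smooth_ext (smooth_add oU (sf i Pi) IH) => // u _; rewrite big_cons
    Pi.
by apply: smooth_ext IH => // u _; rewrite big_cons Pi.
Qed.

Lemma smooth_prod (I : Type) (J : seq I) (P : pred I) d U (f : I -> 'rV[K]_r ->
  K) : open U ->
  (forall i, P i -> smooth_upto d U (f i)) -> smooth_upto d U
    (fun u => \prod_(i <- J | P i) f i u).
Proof.
move=> oU sf; elim: J => [|i J IH].
  by apply: smooth_ext (smooth_cst d 1 oU) => // u _; rewrite big_nil.
case Pi: (P i).
  by apply: smooth_ext (smooth_mul oU (sf i Pi) IH) => // u _; rewrite big_cons
    Pi.
by apply: smooth_ext IH => // u _; rewrite big_cons Pi.
Qed.

(** Functions are total and each clause of [smooth_upto] concerns one point at a time, so the set
    may vary with the point. *)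
Lemma smooth_local d U f :
  (forall u, U u -> exists2 V, V u & smooth_upto d V f) -> smooth_upto d U f.
Proof.
elim: d f => [|d IH] f H /=; (split => [u /H [V Vu [dV _]]|];
  first exact: dV) => // p.
by apply: IH => u /H [V Vu [_ sV]]; exists V => //; exact: sV.
Qed.

Variables (m n : nat).

Lemma differentiable_uptoP d U (g : 'rV[K]_r -> 'M[K]_(m, n)) : open U ->
  differentiable_upto d U g <-> forall i j, smooth_upto d U (fun u => g u i j).
Proof.
move=> oU; elim: d g => [|d IH] g /=; split.
- by move=> [dg _] i j; split => // u Uu; apply: differentiable_mx_entry;
    exact: dg.
- by move=> sg; split => // u Uu; apply: differentiable_mx => i j; have [] :=
    sg i j; auto.
- move=> [dg sg] i j; split => [u Uu|p].
    by apply: differentiable_mx_entry; exact: dg.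
  apply: smooth_ext (proj1 (IH _) (sg p) i j) => // u Uu.
  by rewrite /partial derive_mx_entry //; exact: dg.
- move=> sg; have dg u : U u -> differentiable g u.
    by move=> Uu; apply: differentiable_mx => i j; have [] := sg i j; auto.
  split => // p; apply/IH => i j; have [_ /(_ p)] := sg i j.
  apply: smooth_ext => // u Uu.
  by rewrite /partial derive_mx_entry //; exact: dg.
Qed.

End SmoothFunctions.

(** * Holomorphic matrix functions *)

Section Holomorphic.
Variables (K : numFieldType) (r : nat).
Implicit Types (U : set 'rV[K]_r).

Lemma holomorphicP m n U (g : 'rV[K]_r -> 'M[K]_(m, n)) : open U ->
  holomorphic U g <-> forall d i j, smooth_upto d U (fun u => g u i j).
Proof.
move=> oU; split=> [hg d i j|hg d];
  first exact: (proj1 (differentiable_uptoP _ _ oU) (hg d)).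
by apply/differentiable_uptoP.
Qed.

Lemma holomorphic_differentiable m n U (g : 'rV[K]_r -> 'M[K]_(m, n)) u :
  holomorphic U g -> U u -> differentiable g u.
Proof. by move=> /(_ 0%N) [dg _]; exact: dg. Qed.

Lemma derive_partials (W : normedModType K) (f : 'rV[K]_r -> W) u v :
  differentiable f u -> 'D_v f u = \sum_p v 0 p *: 'D_(delta_mx 0 p) f u.
Proof.
move=> df; rewrite deriveE // {1}[v]row_sum_delta linear_sum; apply: eq_bigr =>
  p _.
by rewrite linearZ deriveE.
Qed.

Lemma holomorphic_subset m n U U' (g : 'rV[K]_r -> 'M[K]_(m, n)) :
  U' `<=` U -> holomorphic U g -> holomorphic U' g.
Proof.
move=> UU hg d; move: (hg d); elim: d g {hg} => [|d IH] g /= [dg sg];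
  split => //.
- by move=> u /UU; exact: dg.
- by move=> u /UU; exact: dg.
by move=> p; exact: IH.
Qed.

Lemma holomorphic_partial m n U (g : 'rV[K]_r -> 'M[K]_(m, n)) p :
  holomorphic U g -> holomorphic U (partial p g).
Proof. by move=> hg d; have [_] := hg d.+1; exact. Qed.

Lemma holomorphic_mulmx m n q U (f : 'rV[K]_r -> 'M[K]_(m, n)) (g : 'rV[K]_r ->
  'M[K]_(n, q)) :
  open U -> holomorphic U f -> holomorphic U g -> holomorphic U
    (fun u => f u *m g u).
Proof.
move=> oU /(holomorphicP _ oU) hf /(holomorphicP _ oU) hg;
  apply/holomorphicP => // d i j.
have : smooth_upto d U (fun u => \sum_k f u i k * g u k j).
  by apply: smooth_sum => // k _; apply: smooth_mul; auto.
by apply: smooth_ext => // u _; rewrite mxE.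
Qed.

Lemma holomorphic_cst m n U (C : 'M[K]_(m, n)) : open U -> holomorphic U
  (fun=> C).
Proof. by move=> oU; apply/holomorphicP => // d i j; exact: smooth_cst. Qed.

Lemma smooth_det n d U (g : 'rV[K]_r -> 'M[K]_n) : open U ->
  (forall i j, smooth_upto d U (fun u => g u i j)) -> smooth_upto d U
    (fun u => \det (g u)).
Proof.
move=> oU hg; rewrite /determinant; apply: smooth_sum => // s _.
by apply: smooth_mul; [|exact: smooth_cst|apply: smooth_prod].
Qed.

(** Cramer's formula: the entries of the inverse are cofactors divided by the determinant. *)
Lemma holomorphic_invmx n U (g : 'rV[K]_r -> 'M[K]_n) : open U ->
  (forall u, U u -> g u \in unitmx) -> holomorphic U g -> holomorphic U
    (fun u => invmx (g u)).
Proof.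
move=> oU gU /(holomorphicP _ oU) hg; apply/holomorphicP => // d i j.
have : smooth_upto d U (fun u => (\det (g u))^-1 * ((-1) ^+ (j + i) * \det
  (row' j (col' i (g u))))).
  apply: smooth_mul => //.
    apply: smooth_inv => //; last exact: smooth_det.
    by move=> u /gU; rewrite unitmxE unitfE.
  apply: smooth_mul => //; first exact: smooth_cst.
  by apply: smooth_det => // a b; apply: smooth_ext
    (hg d (lift j a) (lift i b)) => // u _; rewrite !mxE.
by apply: smooth_ext => // u /gU gu; rewrite /invmx gu !mxE.
Qed.

End Holomorphic.

(** * Symmetry of second derivatives over the complex numbers *)

Section RealRestriction.
Local Open Scope complex_scope.
Variables (R : realType) (V : normedModType R[i]).
Local Notation K := (R[i] : numFieldType).
Implicit Types (f : V -> K) (x v : V).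

Lemma Re_mulr (h : R) (z : R[i]) : complex.Re (h%:C * z) = h * complex.Re z.
Proof. by case: z => a b /=; rewrite mul0r subr0. Qed.

Lemma Re_sub (z w : R[i]) : complex.Re (z - w) = complex.Re z - complex.Re w.
Proof. by case: z; case: w. Qed.

(** At real increments the real part of the complex difference quotient is the real difference
    quotient, and [Re] does not increase the norm. *)
Lemma is_derive_Re f x v (t : R) : derivable f (x + t%:C *: v) v ->
  is_derive t (1 : R) (fun s : R => complex.Re (f (x + s%:C *: v)))
    (complex.Re ('D_v f (x + t%:C *: v))).
Proof.
move=> df; set D := 'D_v f _.
have cD : (fun h : K => h^-1 *: ((f \o shift (x + t%:C *: v)) (h *: v) - f
  (x + t%:C *: v))) @ 0^' --> D.
  exact: df.
suff cR : (fun h : R => h^-1 *: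
  (((fun s : R => complex.Re (f (x + s%:C *: v))) \o shift t) (h *: 1)
  - complex.Re (f (x + t%:C *: v)))) @ 0^' --> complex.Re D.
  split; first by apply/cvg_ex; exists (complex.Re D).
  by apply: cvg_lim cR.
apply/cvgrPdist_lt => e e0.
have eC0 : 0 < e%:C by rewrite ltcR.
move/cvgrPdist_lt : cD => /(_ _ eC0).
rewrite /= !near_withinE => /nbhs_ballP [d d0 H].
(* Radii of balls live in [R[i]], where being positive entails being real. *)
have dE : d = (complex.Re d)%:C by rewrite RRe_real // gtr0_real.
apply/nbhs_ballP; exists (complex.Re d); first by rewrite /= -ltcR -dE.
move=> h; rewrite /ball /= sub0r normrN => hd h0.
have hC : ball (0 : K) d (h%:C : K).
  rewrite -ball_normE /= sub0r normrN dE normc_def /= expr0n addr0 sqrtr_sqr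
    ltcR.
  exact: hd.
have h0C : h%:C != 0 by rewrite eq_complex /= eqxx andbT.
have := H _ hC h0C.
rewrite -ltcR => /(le_lt_trans _); apply.
set z := (X in `|D - X|).
have -> : h^-1 *: (complex.Re (f (x + (h *: 1 + t)%:C *: v)) - complex.Re
  (f (x + t%:C *: v))) = complex.Re z.
  have -> : x + (h *: 1 + t)%:C *: v = h%:C *: v + (x + t%:C *: v).
    by rewrite [h *: 1](mulr1 h) rmorphD scalerDl addrCA.
  rewrite /z -[in RHS]/(h%:C^-1 * _) -fmorphV Re_mulr Re_sub.
  by rewrite -Re_sub.
by rewrite -Re_sub; exact: (normc_ge_Re (D - z : R[i])).
Qed.

(** The mean value equality fails for complex values, hence the restriction to real parts. *)
Lemma MVT_Re f (df : V -> K) x v (h : R) : 0 < h ->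
  (forall t : R, 0 <= t <= h -> is_derive (x + t%:C *: v) v f
    (df (x + t%:C *: v))) ->
  exists2 t : R, 0 <= t <= h &
    complex.Re (f (x + h%:C *: v)) - complex.Re (f x) = complex.Re
      (df (x + t%:C *: v)) * h.
Proof.
move=> h0 H.
have dg t : 0 <= t <= h -> is_derive t (1 : R) (fun s : R => complex.Re
  (f (x + s%:C *: v)))
    (complex.Re (df (x + t%:C *: v))).
  by move=> /H [D <-]; exact: is_derive_Re D.
have [||c] := @MVT R (fun s : R => complex.Re (f (x + s%:C *: v)))
  (fun s : R => complex.Re (df (x + s%:C *: v))) 0 h h0.
- by move=> t; rewrite in_itv /= => /andP[t0 th]; apply: dg; rewrite !ltW.
- apply: derivable_within_continuous => t; rewrite in_itv /= => th.
  by have [] := dg t th.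
rewrite in_itv /= => /andP[c0 ch]; rewrite subr0 scale0r addr0 => E.
by exists c; rewrite ?ltW.
Qed.

Lemma is_derive_shift_arg f (y w v : V) (d : K) :
  is_derive (y + w) v f d -> is_derive y v (fun z => f (z + w)) d.
Proof.
rewrite /derive => -[]; rewrite /derivable /derive.
set F1 := fun k => _ => D1 D2; split; rewrite /derivable /derive; set F2 :=
  fun k => _.
  by suff -> : F2 = F1 by []; apply/funext => k; rewrite /F1 /F2 /= addrA.
by rewrite -D2; suff -> : F2 = F1 by []; apply/funext => k; rewrite /F1 /F2
  /= addrA.
Qed.

(** The mean value theorem is applied twice: to the increment of [f] along [w], as a function in the
    direction [v], then to [D1] in the direction [w]. *)
Lemma second_difference f (D1 D12 : V -> K) x v w (h : R) : 0 < h ->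
  (forall s t : R, 0 <= s <= h -> 0 <= t <= h ->
     is_derive (x + s%:C *: v + t%:C *: w) v f (D1 (x + s%:C *: v + t%:C *: w))
       /\
     is_derive (x + s%:C *: v + t%:C *: w) w D1
       (D12 (x + s%:C *: v + t%:C *: w))) ->
  exists s t : R, [/\ 0 <= s <= h, 0 <= t <= h &
    complex.Re (f (x + h%:C *: v + h%:C *: w) - f (x + h%:C *: v)
                - (f (x + h%:C *: w) - f x))
    = complex.Re (D12 (x + s%:C *: v + t%:C *: w)) * h * h].
Proof.
move=> h0 H.
have hh : 0 <= h <= h by rewrite lexx ltW.
have z0h : 0 <= (0 : R) <= h by rewrite lexx ltW.
pose g y := f (y + h%:C *: w) - f y.
have [|s sh E1] := @MVT_Re g (fun y => D1 (y + h%:C *: w) - D1 y) x v h h0.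
  move=> s sh; apply: is_deriveB.
    by apply: is_derive_shift_arg; have [A1 _] := H s h sh hh; exact: A1.
  have [A1 _] := H s 0 sh z0h; move: A1; rewrite scale0r addr0; exact.
have [|t th E2] := @MVT_Re D1 D12 (x + s%:C *: v) w h h0.
  by move=> t th; have [_ A2] := H s t sh th; exact: A2.
by exists s, t; split => //; rewrite -E2 -!Re_sub -E1 -Re_sub.
Qed.

(** The second difference is symmetric in [v] and [w], so [Re D12] and [Re D21] share a value at two
    points near [x]; continuity at [x] concludes. *)
Lemma Schwarz_Re f (D1 D2 D12 D21 : V -> K) (U : set V) x v w : open U -> U x ->
  (forall y, U y -> [/\ is_derive y v f (D1 y), is_derive y w f (D2 y),
     is_derive y w D1 (D12 y) & is_derive y v D2 (D21 y)]) ->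
  {for x, continuous D12} -> {for x, continuous D21} ->
  complex.Re (D12 x) = complex.Re (D21 x).
Proof.
move=> oU Ux H c1 c2.
apply/eqP; rewrite -subr_eq0 -normr_le0; apply/ler_addgt0Pl => e e0;
  rewrite addr0.
have e2 : 0 < (e / 2)%:C by rewrite ltcR divr_gt0.
have N : \forall y \near x, [/\ U y, `|D12 x - D12 y| < (e / 2)%:C & `|D21 x
  - D21 y| < (e / 2)%:C].
  near=> y; split; near: y; first exact: open_nbhs_nbhs.
    by move/cvgrPdist_lt : c1 => /(_ _ e2).
  by move/cvgrPdist_lt : c2 => /(_ _ e2).
have /nbhs_ballP [d d0 B] := N.
(* This [h] keeps the parallelogram on [h v] and [h w] inside the ball; the [+ 1] in the witness
   covers the case where both directions vanish. *)
have [h h0 hd] : exists2 h : R, 0 < h & h%:C * (`|v| + `|w|) < d.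
  set c := `|v| + `|w|.
  have c0 : 0 <= c by rewrite addr_ge0.
  have cE : c = (complex.Re c)%:C by rewrite RRe_real // ger0_real.
  have dE : d = (complex.Re d)%:C by rewrite RRe_real // gtr0_real.
  have rd0 : 0 < complex.Re d by rewrite -ltcR -dE.
  have rc0 : 0 <= complex.Re c by rewrite -lecR -cE.
  exists (complex.Re d / (complex.Re c + 1)).
    by rewrite divr_gt0 // ltr_pwDr.
  rewrite cE dE -rmorphM ltcR mulrAC ltr_pdivrMr ?ltr_pwDr //.
  by rewrite ltr_pM2l // ltrDl.
have P s t : 0 <= s <= h -> 0 <= t <= h -> ball x d (x + s%:C *: v + t%:C *: w).
  move=> /andP[s0 sh] /andP[t0 th]; rewrite -ball_normE /=.
  rewrite -addrA opprD addNKr normrN; apply: le_lt_trans hd.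
  apply: le_trans (ler_normD _ _) _; rewrite !normrZ mulrDr.
  have nC (k : R) : 0 <= k -> `|k%:C : K| = k%:C by move=> k0;
    rewrite ger0_norm // ler0c.
  by rewrite !nC //; apply: lerD; rewrite ler_wpM2r // lecR.
have [|s1 [t1 [s1h t1h E1]]] := @second_difference f D1 D12 x v w h h0.
  by move=> s t sh th; have [/H [A1 A2 A3 A4] _ _] := B _ (P s t sh th); split;
    [exact: A1|exact: A3].
have [|s2 [t2 [s2h t2h E2]]] := @second_difference f D2 D21 x w v h h0.
  by move=> s t sh th; rewrite addrAC; have [/H [A1 A2 A3 A4] _ _] :=
    B _ (P t s th sh); split;
    [exact: A2|exact: A4].
have EE : complex.Re (D12 (x + s1%:C *: v + t1%:C *: w)) = complex.Re
  (D21 (x + s2%:C *: w + t2%:C *: v)).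
  apply: (mulIf (lt0r_neq0 h0)); apply: (mulIf (lt0r_neq0 h0)).
  by rewrite -E1 -E2 !Re_sub (addrAC x (h%:C *: w) (h%:C *: v)); ring.
have [_ B1 _] := B _ (P _ _ s1h t1h).
have [_ _ B2] := B _ (P _ _ t2h s2h).
have q (z : K) : `|z| < (e / 2)%:C -> `|complex.Re z| < e / 2.
  move=> hz; rewrite -ltcR; apply: le_lt_trans hz.
  exact: (normc_ge_Re (z : R[i])).
move/q: B1; move/q: B2; rewrite addrAC !Re_sub -EE => q2 q1.
rewrite -(subrKA (complex.Re (D12 (x + s1%:C *: v + t1%:C *: w)))) [e]splitr.
by apply: le_trans (ler_normD _ _) _; rewrite lerD ?ltW // distrC.
Unshelve. all: by end_near.
Qed.

(** Since [Re (i z) = - Im z], the real statement for [i f] gives the imaginary parts. *)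
Lemma Schwarz f (D1 D2 D12 D21 : V -> K) (U : set V) x v w : open U -> U x ->
  (forall y, U y -> [/\ is_derive y v f (D1 y), is_derive y w f (D2 y),
     is_derive y w D1 (D12 y) & is_derive y v D2 (D21 y)]) ->
  {for x, continuous D12} -> {for x, continuous D21} ->
  D12 x = D21 x.
Proof.
move=> oU Ux H c1 c2.
have R1 := Schwarz_Re oU Ux H c1 c2.
have iS (g : V -> K) y u (d : K) : is_derive y u g d -> is_derive y u
  (('i%C : K) \*: g) (('i%C : K) *: d).
  exact: is_deriveZ.
have := @Schwarz_Re (('i%C : K) \*: f) (('i%C : K) \*: D1) (('i%C : K) \*: D2)
  (('i%C : K) \*: D12) (('i%C : K) \*: D21) U x v w oU Ux.
have iC (g : V -> K) : {for x, continuous g} ->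
  {for x, continuous (('i%C : K) \*: g)}.
  by move=> cg; exact: continuousZl_tmp cg.
move=> /(_ _ (iC _ c1) (iC _ c2)) => R2.
have {}R2 := R2 (fun y Uy => let: And4 a b c d := H y Uy in And4 (iS _ _ _ _ a)
  (iS _ _ _ _ b) (iS _ _ _ _ c) (iS _ _ _ _ d)).
move: R1 R2 => /=; move: (D12 x) (D21 x) => [a b] [c d] /= ->.
by rewrite !mul0r !sub0r !mul1r => /oppr_inj ->.
Qed.

(** The mean value points for [f] and [i f] may differ; this is harmless because the derivative
    vanishes at both. *)
Lemma derive0_const_segment f x v :
  (forall t : R, 0 <= t <= 1 -> is_derive (x + t%:C *: v) v f 0) ->
  f (x + v) = f x.
Proof.
move=> H.
have [t th E1] := @MVT_Re f (cst 0) x v 1 ltr01 H.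
have H' t' : 0 <= t' <= 1 -> is_derive (x + t'%:C *: v) v (('i%C : K) \*: f)
  (cst 0 (x + t'%:C *: v)).
  by move=> /H A1; have := is_deriveZ ('i%C : K) A1; rewrite scaler0; exact.
have [s sh E2] := @MVT_Re (('i%C : K) \*: f) (cst 0) x v 1 ltr01 H'.
move: E1 E2; rewrite /= !mul0r scale1r.
move: (f _) (f _) => [a b] [c d] /= /eqP; rewrite subr_eq0 => /eqP ->.
by rewrite !mul0r !sub0r !mul1r => /eqP; rewrite subr_eq0 => /eqP /oppr_inj ->.
Qed.
End RealRestriction.

(** * Self-adjoint maps of a regular pencil *)

Section LinearAlgebra.
Variable F : fieldType.

(** [x *m invmx E] holds the coordinates of the rows of [x] in the frame [E]. *)
Lemma span_rowsP n (E : 'M[F]_n) (P : pred 'I_n) m (x : 'M[F]_(m, n)) :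
  E \in unitmx ->
  (x <= \sum_(i < n | P i) <<row i E>>)%MS <->
  forall i j, ~~ P j -> (x *m invmx E) i j = 0.
Proof.
move=> EU; split=> [|H].
  move=> /sub_sumsmxP [w ->] i j Pj; rewrite mulmx_suml summxE big1 // => k Pk.
  have /submxP [D ->] : (w k *m <<row k E>> <= row k E)%MS.
    by apply: submx_trans (submxMl _ _) _; rewrite genmxE.
  rewrite -mulmxA -row_mul mulmxV // mxE big1 // => a _.
  by rewrite !mxE (_ : (k == j) = false) ?mulr0 //; apply: contraNF Pj =>
    /eqP <-.
apply/row_subP => i; rewrite -[x](mulmxKV EU) row_mul mulmx_sum_row.
apply: summx_sub => j _; case Pj: (P j); last by rewrite mxE H ?Pj // scale0r
  sub0mx.
by apply: scalemx_sub; apply: (sumsmx_sup j) => //; rewrite genmxE.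
Qed.

Lemma eigenvectors_row_free r (Z Y : 'M[F]_r) (d : 'I_r -> F) :
  injective d -> (forall i, row i Y *m Z = d i *: row i Y) ->
  (forall i, row i Y != 0) -> Y \in unitmx.
Proof.
move=> injd eigY Y0; rewrite -row_free_unit -kermx_eq0; apply/rowV0P =>
  c /sub_kermxP cY.
apply/rowP => i; rewrite mxE; apply/eqP; apply: contraT => ci.
have dir : mxdirect (\sum_(i < r) eigenspace Z (d i))%MS.
  by apply: mxdirect_sum_eigenspace => a b _ _; exact: injd.
have in_eig j : (c 0 j *: row j Y <= eigenspace Z (d j))%MS.
  by apply: scalemx_sub; apply/eigenspaceP.
have /mxdirect_sumsP /(_ i isT) cap := dir.
have : (c 0 i *: row i Y <= eigenspace Z (d i) :&:
  \sum_(j < r | true && (j != i)) eigenspace Z (d j))%MS.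
  rewrite sub_capmx in_eig /=.
  have : c 0 i *: row i Y = - \sum_(j < r | j != i) c 0 j *: row j Y.
    by move: cY; rewrite mulmx_sum_row (bigD1 i) //= => /eqP;
      rewrite addr_eq0 => /eqP.
  move=> ->; rewrite eqmx_opp; apply: summx_sub => j ji.
  by apply: submx_trans (in_eig j) _; apply: (sumsmx_sup j).
rewrite cap submx0 scaler_eq0 (negPf ci) /= => /eqP h.
by move: (Y0 i); rewrite h eqxx.
Qed.

Lemma commute_distinct_eigenvalues_eq0 r (Z Y C : 'M[F]_r) (d : 'I_r -> F) :
  injective d -> (forall i, row i Y *m Z = d i *: row i Y) ->
  (forall i, row i Y != 0) -> C *m Z = Z *m C ->
  (forall a, a != 0 -> C + a%:M \in unitmx) -> C = 0.
Proof.
move=> injd eigY Y0 CZ CU.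
have YU := eigenvectors_row_free injd eigY Y0.
have [X YC] : exists X, Y *m C = X *m Y.
  by exists (Y *m C *m invmx Y); rewrite mulmxKV.
pose D := diag_mx (\row_i d i).
have YZ : Y *m Z = D *m Y.
  by apply/row_matrixP => i; rewrite !row_mul eigY row_diag_mx !mxE -scalemxAl
    -rowE.
have XD : X *m D = D *m X.
  apply: (can_inj (mulmxK YU)).
  by rewrite -!mulmxA -YZ -YC !mulmxA -YC -YZ -!mulmxA CZ.
have Xd i : row i Y *m C = X i i *: row i Y.
  rewrite -row_mul YC row_mul [row i X]matrix_sum_delta big_ord1 mulmx_suml
    (bigD1 i) //=.
  rewrite mxE -scalemxAl -rowE big1 ?addr0 // => j ji; rewrite mxE.
  suff -> : X i j = 0 by rewrite scale0r mul0mx.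
  move/matrixP/(_ i j): XD; rewrite mul_mx_diag mul_diag_mx !mxE => /eqP.
  rewrite mulrC -subr_eq0 -mulrBl mulf_eq0 subr_eq0 =>
    /orP [/eqP /injd ej|/eqP //].
  by rewrite ej eqxx in ji.
(* A nonzero [X i i] would be an eigenvalue of [C], making [C - X i i] singular. *)
have X0 i : X i i = 0.
  apply/eqP; apply: contraT => Xi.
  have /CU CX : - X i i != 0 by rewrite oppr_eq0.
  move: (Y0 i); rewrite -[row i Y](mulmxK CX) mulmxDr Xd mul_mx_scalar scaleNr
    subrr mul0mx.
  by rewrite eqxx.
apply: (can_inj (mulKmx YU)); rewrite mulmx0; apply/row_matrixP => i.
by rewrite row_mul Xd X0 scale0r row0.
Qed.
End LinearAlgebra.

Lemma horner_pencil_char_poly (K : numFieldType) r (B1 B2 : 'M[K]_r) a :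
  (pencil_char_poly B1 B2).[a] = \det (B2 + a *: B1).
Proof.
rewrite /pencil_char_poly -horner_evalE -det_map_mx; congr (\det _).
by apply/matrixP => i j; rewrite !mxE /= /horner_eval hornerD hornerC hornerM
  hornerX hornerC.
Qed.

(** In characteristic 0 there are [size p] distinct natural numbers, more than [p] can have
    roots. *)
Lemma exists_nonroot (K : numFieldType) (p : {poly K}) : p != 0 -> exists a,
  p.[a] != 0.
Proof.
move=> p0; apply: contrapT => H.
have := @max_poly_roots _ p [seq i%:R | i <- iota 0 (size p)] p0.
rewrite size_map size_iota ltnn => E.
suff : false by [].
apply: E.
  apply/allP => x _; apply/negPn/negP => px; apply: H; exists x.
  by move: px; rewrite rootE.
by rewrite map_inj_uniq ?iota_uniq // => i j /eqP; rewrite eqr_nat => /eqP.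
Qed.

(* A value of the characteristic polynomial that is not 0 gives an invertible
   B0 = B2 + a0 B1.  Put H1 = P B1 Q and H0 = P B0 Q: then C commutes with
   H1 H0^-1, which has distinct eigenvalues, so C is diagonal in an eigenbasis
   of it, and the eigenvalues of C vanish. *)
Lemma selfadjoint_regular_pencil_eq0 (K : numFieldType) r
    (B1 B2 P Q C : 'M[K]_r) :
  regular_pencil B1 B2 -> distinct_eigenvalues B1 B2 ->
  P \in unitmx -> Q \in unitmx ->
  (forall B, B = B1 \/ B = B2 -> (P *m B *m Q)^T = P *m B *m Q) ->
  (forall B, B = B1 \/ B = B2 -> (C *m (P *m B *m Q))^T = C *m (P *m B *m Q)) ->
  (forall a, a != 0 -> C + a%:M \in unitmx) -> C = 0.
Proof.
move=> reg [e [size_e uniq_e root_e]] PU QU sym selfadj CU.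
have [a0] := exists_nonroot reg; rewrite horner_pencil_char_poly => a0P.
set B0 := B2 + a0 *: B1 in a0P.
have B0U : B0 \in unitmx by rewrite unitmxE unitfE.
pose H1 := P *m B1 *m Q; pose H0 := P *m B0 *m Q.
have H0E : H0 = P *m B2 *m Q + a0 *: H1 by rewrite /H0 /B0 mulmxDr mulmxDl
  -scalemxAr -scalemxAl.
have H0U : H0 \in unitmx by rewrite !unitmx_mul PU B0U.
have CH1 : C *m H1 = H1 *m C^T by rewrite -[LHS](selfadj B1 (or_introl erefl))
  trmx_mul (sym B1 (or_introl erefl)).
have CH0 : C *m H0 = H0 *m C^T.
  rewrite H0E mulmxDr mulmxDl -scalemxAr CH1 -scalemxAl; congr (_ + _).
  by rewrite -[LHS](selfadj B2 (or_intror erefl)) trmx_mul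
    (sym B2 (or_intror erefl)).
pose Z := H1 *m invmx H0.
have CZ : C *m Z = Z *m C.
  rewrite /Z mulmxA CH1 -[LHS]mulmxA -[RHS]mulmxA; congr (_ *m _).
  by apply: (can_inj (mulKmx H0U)); rewrite [LHS]mulmxA -CH0 mulmxK // mulKVmx.
have ex (i : 'I_r) : exists x : 'rV[K]_r, x != 0 /\ x *m (B2 + e`_i *: B1) = 0.
  have /(allP root_e) : e`_i \in e by rewrite mem_nth // size_e.
  rewrite rootE horner_pencil_char_poly => d0.
  have : kermx (B2 + e`_i *: B1) != 0.
    by rewrite kermx_eq0 row_free_unit unitmxE unitfE d0.
  by move=> /rowV0Pn [x /sub_kermxP xk x0]; exists x.
have [x xP] := choice ex.
pose Y := \matrix_i (x i *m invmx P).
have rowY i : row i Y = x i *m invmx P by rewrite rowK.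
have ne (i : 'I_r) : a0 - e`_i != 0.
  rewrite subr_eq0; apply/negP => /eqP E; have [x0 xk] := xP i.
  by move: a0P; rewrite /B0 E => /det0P; case; exists (x i).
(* Because [x i] kills [B2 + e_i B1], it satisfies [x i *m B0 = (a0 - e_i) *: (x i *m B1)]; this
   produces the eigenvalue [(a0 - e_i)^-1] of [Z] on [x i *m invmx P]. *)
apply: (@commute_distinct_eigenvalues_eq0 _ _ Z Y C (fun i => (a0 - e`_i)^-1))
  CZ CU.
- move=> i j /invr_inj /addrI /oppr_inj /eqP; rewrite nth_uniq ?size_e // =>
    /eqP.
  exact: val_inj.
- move=> i; rewrite rowY /Z; have [x0 xk] := xP i.
  apply: (can_inj (mulmxK H0U)); rewrite [X in X *m H0 = _]mulmxA
    mulmxKV // -scalemxAl.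
  rewrite /H1 /H0 !mulmxA !(mulmxKV PU).
  have -> : x i *m B0 = (a0 - e`_i) *: (x i *m B1).
    rewrite /B0 -[a0 in LHS](subrK e`_i) [_ + e`_i]addrC scalerDl addrA mulmxDr
      xk add0r.
    by rewrite -scalemxAr.
  by rewrite -scalemxAl scalerA mulVf // scale1r.
- move=> i; rewrite rowY; have [x0 _] := xP i.
  apply: contra x0 => /eqP h; by rewrite -[x i](mulmxKV PU) h mul0mx.
Qed.

(** The lower block of [tangent], with the partial derivatives replaced by arbitrary matrices, so
    that the argument at one point is pure linear algebra. *)
Definition displacements (K : numFieldType) (r k N : nat)
  (D : 'I_r -> 'M[K]_(k, N)) (s : 'rV[K]_k) :=
  \matrix_(p < r) (s *m D p).

Lemma displacements_lin (K : numFieldType) (r k N : nat)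
  (D : 'I_r -> 'M[K]_(k, N)) s a s' :
  displacements D (s + a *: s') = displacements D s + a *: displacements D s'.
Proof.
by apply/matrixP => p j; rewrite mxE mulmxDl -scalemxAl !mxE.
Qed.

Lemma sub_col_mx_ex (F : fieldType) k1 k2 n p (A : 'M[F]_(k1, n))
  (B : 'M[F]_(k2, n)) (x : 'M[F]_(p, n)) :
  (x <= col_mx A B)%MS -> exists X Y, x = X *m A + Y *m B.
Proof.
by move=> /submxP [D ->]; exists (lsubmx D), (rsubmx D); rewrite -mul_row_col
  hsubmxK.
Qed.

(* A spans a generator, D p is its derivative in the direction p and h is its
   column of index 0.  The columns of T1 and T2 are the derivatives of two
   sections of the conormal bundle, Fr and G are the part l < i <= n of an
   adapted frame and of the dual frame; s1 is the point A_0 of that frame.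
   Modulo A, [displacements D s = C *m displacements D s0]; the matrices
   [displacements D s0 *m T] are congruent to the second fundamental forms, and
   C is self-adjoint for both of them. *)
Lemma displacement_at_infinity (K : numFieldType) (k r N : nat)
    (A : 'M[K]_(k, N)) (D : 'I_r -> 'M[K]_(k, N)) (h : 'cV[K]_k)
      (s0 s1 : 'rV[K]_k)
    (G : 'M[K]_(N, r)) (Fr : 'M[K]_(r, N)) (B1 B2 : 'M[K]_r)
      (T1 T2 : 'M[K]_(N, r)) :
  s0 *m h != 0 ->
  (forall s, s *m h != 0 -> row_free (col_mx A (displacements D s))) ->
  (forall s, displacements D s <= col_mx A (displacements D s0))%MS ->
  A *m G = 0 -> Fr *m G = 1%:M ->
  (Fr <= col_mx A (displacements D s0))%MS ->
  (Fr <= col_mx A (displacements D s1))%MS ->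
  regular_pencil B1 B2 -> distinct_eigenvalues B1 B2 ->
  (forall B T, (B, T) = (B1, T1) \/ (B, T) = (B2, T2) ->
    [/\ A *m T = 0, forall s, (displacements D s *m T)^T = displacements D s *m
      T
      & Fr *m T = - (B *m (displacements D s1 *m G)^T)]) ->
  forall s, s *m h = 0 -> (displacements D s <= A)%MS.
Proof.
move=> s0h rfree span AG FrG Fr0 Fr1 reg dist HT s sh.
set M := displacements D.
have [X [m FrE]] := sub_col_mx_ex Fr0; have [X' [m' FrE']] := sub_col_mx_ex Fr1.
have [Y [C ME]] := sub_col_mx_ex (span s).
rewrite -/M in FrE FrE' ME HT.
(* [G] kills [A] and is dual to [Fr]: multiplying by it drops the components along the generator and
   shows that the change of basis is invertible. *)
have mG : m *m (M s0 *m G) = 1%:M.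
  by move: FrG; rewrite FrE mulmxDl -mulmxA AG mulmx0 add0r mulmxA.
have m'G : m' *m (M s1 *m G) = 1%:M.
  by move: FrG; rewrite FrE' mulmxDl -mulmxA AG mulmx0 add0r mulmxA.
have [mU _] := mulmx1_unit mG.
have [_ WU] := mulmx1_unit m'G.
set W := M s1 *m G in WU HT.
(* The left factor comes from [s0] and the right one from [s1], which may be different points of the
   generator; hence two separate factors [P] and [Q] in [selfadjoint_regular_pencil_eq0]. *)
have HE B T : (B, T) = (B1, T1) \/ (B, T) = (B2, T2) -> M s0 *m T = (- invmx m)
  *m B *m W^T.
  move=> /HT [AT _ FT]; apply: (can_inj (mulKmx mU)).
  rewrite -[in RHS]mulmxA mulNmx mulmxN mulKVmx // -FT FrE mulmxDl -mulmxA AT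
    mulmx0 add0r.
  by rewrite mulmxA.
suff C0 : C = 0 by rewrite ME C0 mul0mx addr0 submxMl.
have cases B : B = B1 \/ B = B2 -> exists T, (B, T) = (B1, T1) \/ (B, T)
  = (B2, T2).
  by case=> ->; [exists T1; left|exists T2; right].
apply: (@selfadjoint_regular_pencil_eq0 _ _ B1 B2 (- invmx m) W^T C) => //.
- by rewrite -scaleN1r unitmxZ ?unitmx_inv // unitrN1.
- by rewrite unitmx_tr.
- by move=> B /cases [T BT]; rewrite -(HE B T BT); have [_ -> _] := HT _ _ BT.
- move=> B /cases [T BT]; rewrite -(HE B T BT) mulmxA; have [AT symT _] :=
    HT _ _ BT.
  have -> : C *m M s0 *m T = M s *m T by rewrite ME mulmxDl -(mulmxA Y) AT
    mulmx0 add0r.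
  exact: symT.
(* Modulo [A], the displacements of the affine point [s + a s0] are [C + a] times those of [s0]; a
   left kernel vector of [C + a] would contradict their independence. *)
move=> a a0; have sa : (s + a *: s0) *m h != 0.
  by rewrite mulmxDl sh add0r -scalemxAl scaler_eq0 (negPf a0).
rewrite -row_free_unit -kermx_eq0; apply/rowV0P => w /sub_kermxP wC.
have := rfree _ sa; rewrite displacements_lin -/M ME -kermx_eq0 => /rowV0P.
move=> /(_ (row_mx (- (w *m Y)) w)) H.
suff /H : (row_mx (- (w *m Y)) w <= kermx
  (col_mx A (Y *m A + C *m M s0 + a *: M s0)))%MS.
  by rewrite -row_mx0 => /eq_row_mx [].
apply/sub_kermxP; rewrite mul_row_col -addrA -mul_scalar_mx -mulmxDl mulmxDr
  !mulmxA wC mul0mx.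
by rewrite addr0 mulNmx addNr.
Qed.

(** * Generators are stable at infinity *)

Lemma at_infinity_col (K : numFieldType) k N (s : 'rV[K]_k)
  (A : 'M[K]_(k, N.+1)) :
  at_infinity (s *m A) <-> s *m col 0 A = 0.
Proof.
rewrite colE mulmxA -colE /at_infinity; split=> [H|/matrixP /(_ 0 0)];
  last by rewrite !mxE.
by apply/matrixP => i j; rewrite !ord1 mxE H mxE.
Qed.

Section Lift.
Local Open Scope complex_scope.
Variables (R : realType).
Local Notation K := (R[i] : numFieldType).

Lemma partial_comm r k N (A : 'rV[K]_r -> 'M[K]_(k, N)) (U : set 'rV[K]_r) u p
  q :
  open U -> U u -> holomorphic U A ->
  partial q (partial p A) u = partial p (partial q A) u.
Proof.
move=> oU Uu hA.
have dA := holomorphic_differentiable hA.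
have dP p' : forall y, U y -> differentiable (partial p' A) y.
  by move=> y; apply: holomorphic_differentiable; exact: holomorphic_partial.
have dPP p' q' : forall y, U y -> differentiable (partial q' (partial p' A)) y.
  by move=> y; apply: holomorphic_differentiable;
    do 2 apply: holomorphic_partial.
apply/matrixP => i j.
have D (g : 'rV[K]_r -> 'M[K]_(k, N)) p' y : differentiable g y ->
    is_derive y (delta_mx 0 p') (fun z => g z i j) (partial p' g y i j).
  move=> dg; rewrite /partial derive_mx_entry //; apply: DeriveDef => //.
  by apply: diff_derivable; exact: differentiable_mx_entry.
have := @Schwarz R _ (fun z => A z i j) (fun z => partial p A z i j)
  (fun z => partial q A z i j)
  (fun z => partial q (partial p A) z i j) (fun z => partial p (partial q A) z i
    j) U u
  (delta_mx 0 p) (delta_mx 0 q) oU Uu; apply.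
- move=> y Uy; split.
  + by apply: D; exact: dA.
  + by apply: D; exact: dA.
  + by apply: D; exact: dP.
  + by apply: D; exact: dP.
- by apply: differentiable_continuous; apply: differentiable_mx_entry;
    exact: dPP.
- by apply: differentiable_continuous; apply: differentiable_mx_entry;
    exact: dPP.
Qed.

(* With [eta] a conormal section, differentiating [partial p A *m eta = 0] gives
   [partial p A *m partial q eta = - partial q (partial p A) *m eta], which is
   symmetric in p and q: this is the source of all the symmetries. *)
Lemma lift_infinity_stable (l r n N : nat) (A : 'rV[K]_r -> 'M[K]_(l.+1, N.+1))
    (U : set 'rV[K]_r) (u : 'rV[K]_r) :
  n = (l + r)%N -> open U -> U u -> holomorphic U A ->
  \rank (tangent_along A u) = n.+1 ->
  (forall s, ~ at_infinity (s *m A u) -> regular_point A u s) ->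
  (exists s, ~ at_infinity (s *m A u)) ->
  (exists U' E b xi1 xi2,
      [/\ [/\ open U', U' `<=` U & U' u],
          adapted_frame n A U' E,
          second_fundamental_forms l n E u b,
          regular_pencil (pencil_form n b xi1) (pencil_form n b xi2) &
          distinct_eigenvalues (pencil_form n b xi1) (pencil_form n b xi2)]) ->
  forall s p, at_infinity (s *m A u) -> (s *m partial p A u <= A u)%MS.
Proof.
move=> hn oU Uu hA rkT reg [s0 s0inf]
  [U' [E [b [xi1 [xi2 [[oU' U'U U'u] [hE frame] sff regp dist]]]]]].
set D := fun p => partial p A u.
have nN : (n <= N)%N by rewrite -ltnS -rkT rank_leq_col.
have ltN (q : 'I_r) : (l.+1 + q < N.+1)%N.
  by rewrite (leq_trans _ (nN : n.+1 <= N.+1)%N) // hn addSn ltnS ltn_add2l.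
have DT s : (displacements D s <= tangent_along A u)%MS.
  apply/row_subP => p; rewrite rowK; apply: submx_trans (submxMl _ _) _.
  apply: submx_trans (addsmxSr _ _); apply: (sumsmx_sup p) => //;
    by rewrite genmxE.
have TE s : regular_point A u s -> (tangent_along A u <= col_mx (A u)
  (displacements D s))%MS.
  by move=> /eqmxP e; rewrite -e.
have [EU EA ET [s1 E0 reg1]] := frame u U'u.
(* The columns of [X] form the dual frame: those of index above [l] annihilate the generator, those
   above [n] its tangent space. *)
set X := fun u => invmx (E u).
have hX : holomorphic U' X.
  by apply: holomorphic_invmx => // v Uv; have [? _ _ _] := frame v Uv.
have dE : differentiable E u by exact: holomorphic_differentiable hE _.
have dX : differentiable X u by exact: holomorphic_differentiable hX _.
have dA v : U' v -> differentiable A v by move=> /U'U;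
  exact: holomorphic_differentiable.
have AX v : U' v -> forall i (j : 'I_N.+1), (l < j)%N -> (A v *m X v) i j = 0.
  move=> Uv i j lj; have [EvU EvA _ _] := frame v Uv.
  have : (A v <= \sum_(i < N.+1 | (i <= l)%N) <<row i (E v)>>)%MS
    by rewrite (eqmxP EvA).
  by move=> /(span_rowsP _ _ EvU); apply; rewrite -ltnNge.
have TX v m (x : 'M[K]_(m, N.+1)) : U' v -> (x <= tangent_along A v)%MS ->
  forall i (j : 'I_N.+1), (n < j)%N -> (x *m X v) i j = 0.
  move=> Uv + i j nj; have [EvU _ EvT _] := frame v Uv.
  by rewrite -(eqmxP EvT) => /(span_rowsP _ _ EvU); apply; rewrite -ltnNge.
have dEX q : partial q E u *m X u + E u *m partial q X u = 0.
  rewrite -(derive_mulmx _ dE dX).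
  rewrite (derive_congr_open (g := fun=> 1%:M) _ oU' U'u) ?derive_cst //.
  by move=> y Uy; rewrite mulmxV //; have [] := frame y Uy.
have dAX q i (j : 'I_N.+1) : (l < j)%N -> (partial q A u *m X u + A u *m partial
  q X u) i j = 0.
  move=> lj; rewrite -(derive_mulmx _ (dA _ U'u) dX).
  rewrite derive_mx_entry; last by apply: differentiable_mulmx => //; exact: dA.
  rewrite (derive_congr_open (g := fun=> 0) _ oU' U'u) ?derive_cst //.
  by move=> y Uy; rewrite AX.
pose ind (q : 'I_r) : 'I_N.+1 := inord (l.+1 + q).
have indE q : ind q = (l.+1 + q)%N :> nat by rewrite inordK.
pose G := colsub ind (X u); pose Fr := rowsub ind (E u).
have FrT : (Fr <= tangent_along A u)%MS.
  rewrite -(eqmxP ET); apply/row_subP => p; rewrite row_rowsub.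
  by apply: (sumsmx_sup (ind p)); rewrite ?genmxE // indE hn addSn ltn_add2l.
(* Cutting [xi] off at indices up to [n] matches the range of the sum in [pencil_form] and makes
   [eta xi] a conormal section. *)
pose c (xi : 'I_N.+1 -> K) : 'cV[K]_N.+1 := \col_a (if (n < a)%N then xi a else
  0).
pose eta xi v := X v *m c xi.
pose T xi : 'M[K]_(N.+1, r) := \matrix_(j, q) (partial q (eta xi) u) j 0.
have dT xi q : partial q (eta xi) u = partial q X u *m c xi.
  by rewrite /partial /eta derive_mulmxr.
have eta0 xi v m (x : 'M[K]_(m, N.+1)) : U' v -> (x <= tangent_along A v)%MS ->
  x *m eta xi v = 0.
  move=> Uv xT; apply/matrixP => i j; rewrite /eta mulmxA mxE [RHS]mxE
    big1 // => a _.
  rewrite [c _ _ _]mxE; case: ifP => na; last by rewrite mulr0.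
  by rewrite (TX v) ?mul0r.
have AT v : (A v <= tangent_along A v)%MS by exact: addsmxSl.
have PT v p : (partial p A v <= tangent_along A v)%MS.
  by apply: submx_trans (addsmxSr _ _); apply: (sumsmx_sup p) => //;
    rewrite genmxE.
have colT xi q m (x : 'M[K]_(m, N.+1)) p : (x *m T xi) p q
  = (x *m partial q (eta xi) u) p 0.
  by rewrite !mxE; apply: eq_bigr => a _; rewrite mxE.
have deta xi : differentiable (eta xi) u by exact: differentiable_mulmxr.
(* Differentiating [A *m eta = 0] leaves only this term, since the derivatives of [A] lie in the
   tangent space along the generator and are killed by [eta]. *)
have Adeta xi q : A u *m partial q (eta xi) u = 0.
  have : partial q A u *m eta xi u + A u *m partial q (eta xi) u = 0.
    rewrite -(derive_mulmx _ (dA _ U'u) (deta xi)).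
    rewrite (derive_congr_open (g := fun=> 0) _ oU' U'u) ?derive_cst //.
    by move=> y Uy; exact: (eta0 xi y _ _ Uy (AT y)).
  by rewrite (eta0 xi u _ _ U'u (PT u q)) add0r.
have Pdeta xi p q : partial p A u *m partial q (eta xi) u
  = - (partial q (partial p A) u *m eta xi u).
  have dP : differentiable (partial p A) u.
    by apply: holomorphic_differentiable Uu; exact: holomorphic_partial.
  apply/eqP; rewrite -addr_eq0 addrC; apply/eqP.
  rewrite -(derive_mulmx _ dP (deta xi)).
  rewrite (derive_congr_open (g := fun=> 0) _ oU' U'u) ?derive_cst //.
  by move=> y Uy; exact: (eta0 xi y _ _ Uy (PT y p)).
move=> s p sinf.
suff : (displacements D s <= A u)%MS by move=> /row_subP /(_ p); rewrite rowK.
apply: (@displacement_at_infinity K _ _ _ (A u) D (col 0 (A u)) s0 s1 G Fr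
  (pencil_form n b xi1) (pencil_form n b xi2) (T xi1) (T xi2)) => //.
- by apply/eqP => /at_infinity_col.
- move=> s' /eqP s'inf.
  have /reg /eqmxP e : ~ at_infinity (s' *m A u) by move=> /at_infinity_col.
  by rewrite /row_free -[col_mx _ _]/(tangent A u s') e rkT hn -addSn.
- by move=> s'; apply: submx_trans (DT s') _; apply: TE; exact: reg.
- by apply/matrixP => i q; rewrite mulmx_colsub !mxE -[RHS](AX _ U'u i (ind q))
    ?mxE // indE leq_addr.
- rewrite mulmx_colsub mul_rowsub_mx mulmxV //; apply/matrixP => i j;
    rewrite !mxE.
  by rewrite -val_eqE /= !indE eqn_add2l.
- by apply: submx_trans FrT _; apply: TE; exact: reg.
- by apply: submx_trans FrT _; exact: TE.
- have main xi : [/\ A u *m T xi = 0, forall s, (displacements D s *m T xi)^T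
    = displacements D s *m T xi
      & Fr *m T xi = - (pencil_form n b xi *m (displacements D s1 *m G)^T)].
    split.
    + by apply/matrixP => i q; rewrite colT Adeta !mxE.
    + move=> s'; apply/matrixP => i j; rewrite mxE !colT.
      have rw a q : (displacements D s' *m partial q (eta xi) u) a
        0 = (s' *m (partial a A u *m partial q (eta xi) u)) 0 0.
        by rewrite mulmxA [LHS]mxE [RHS]mxE; apply: eq_bigr => t _; rewrite mxE.
      apply: etrans (rw j i) _; apply: etrans _ (esym (rw i j)).
      have e : partial j A u *m partial i (eta xi) u = partial i A u *m partial
        j (eta xi) u.
        apply: etrans (Pdeta xi j i) _; apply: etrans _ (esym (Pdeta xi i j)).
        by have -> := partial_comm j i oU Uu hA.
      exact: (congr1 (fun Z : 'cV[K]_l.+1 => (s' *m Z) 0 0) e).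
    (* The coefficients [s] with [row 0 (E v) = s *m A v] are given point by point, with no
       regularity in [v]. The derivatives of [row 0 E] and of [s1 *m A] are therefore compared
       through that of [X], from [E *m X = 1] and the vanishing of the columns of [A *m X] beyond
       [l]. *)
    have W0 j t : (partial j E u *m X u) 0 (ind t) = (displacements D s1 *m G) j
      t.
      have lt : (l < ind t)%N by rewrite indE leq_addr.
      have e1 : (partial j E u *m X u) 0 (ind t) = - (row 0 (E u) *m partial j X
        u) 0 (ind t).
        apply/eqP; rewrite -addr_eq0 -row_mul [X in _ + X]mxE.
        by have /matrixP /(_ 0 (ind t)) := dEX j; rewrite mxE [RHS]mxE => ->.
      have e2 : (s1 *m partial j A u *m X u) 0 (ind t) = - (s1 *m A u *m partial
        j X u) 0 (ind t).
        apply/eqP; rewrite -addr_eq0 -!mulmxA !(mxE, summxE) -big_split /=.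
        apply/eqP; rewrite big1 // => a _; rewrite -mulrDr.
        by have := dAX j a _ lt; rewrite mxE => ->; rewrite mulr0.
      rewrite e1 E0 -e2 /G mulmx_colsub [RHS]mxE [RHS]mxE [LHS]mxE.
      by apply: eq_bigr => a _; congr (_ * _); rewrite !mxE.
    apply/matrixP => i j; rewrite colT dT.
    (* Passing from the derivative of the dual frame to that of the frame costs the minus sign in
       the relation between [Fr *m T xi] and the pencil form; the forms [omega_p^alpha] then
       appear. *)
    have -> : (Fr *m (partial j X u *m c xi)) i 0 = - (partial j E u *m X u *m c
      xi) (ind i) 0.
      rewrite /Fr mul_rowsub_mx mxE mulmxA; apply/eqP; rewrite -addr_eq0 addrC.
      have /(congr1 (fun Z : 'M[K]_N.+1 => (Z *m c xi) (ind i) 0)) /= := dEX j.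
      by rewrite mulmxDl mxE mul0mx [RHS]mxE => ->.
    rewrite [RHS]mxE; congr (- _); rewrite mxE [RHS]mxE.
    under [RHS]eq_bigr => t _ do rewrite mxE -W0 /pencil_form summxE mulr_suml.
    rewrite exchange_big /= [RHS]big_mkcond /=; apply: eq_bigr => a _.
    rewrite [c _ _ _]mxE; case: ifP => na; last by rewrite mulr0.
    have [_ /(_ (delta_mx 0 j) i) sffa] := sff a na.
    rewrite [X in X * _]sffa mulr_suml; apply: eq_bigr => t _.
    by rewrite [X in _ = X * _]mxE [LHS]mulrC mulrA.
  by move=> B T' [] [-> ->]; exact: main.
- by apply/at_infinity_col.
Qed.

End Lift.

(** * The part at infinity of a generator is locally constant *)

(** The intersection with the hyperplane at infinity, written as a product: once the column of index
    0 is normalized to a constant, it can be differentiated. *)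
Definition infinity_part (F : fieldType) k N (A : 'M[F]_(k, N.+1)) :=
  kermx (col 0 A) *m A.

Lemma infinity_partP (F : fieldType) k N m (A : 'M[F]_(k, N.+1))
  (x : 'M[F]_(m, N.+1)) :
  (x <= infinity_part A)%MS <-> (x <= A)%MS /\ col 0 x = 0.
Proof.
split=> [/submxP [w ->]|[/submxP [w ->]]].
  rewrite /infinity_part mulmxA submxMl; split=> //.
  by rewrite colE -mulmxA -colE -mulmxA mulmx_ker mulmx0.
rewrite colE -mulmxA -colE => /sub_kermxP wk.
exact: submxMr.
Qed.

Lemma infinity_part_eqmx (F : fieldType) k k' N (A : 'M[F]_(k, N.+1))
  (A' : 'M[F]_(k', N.+1)) :
  (A :=: A')%MS -> (infinity_part A == infinity_part A')%MS.
Proof.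
move=> e; apply/andP; split; apply/infinity_partP; rewrite ?e; [rewrite -e|].
  by apply/infinity_partP.
by apply/infinity_partP.
Qed.

Section Constancy.
Local Open Scope complex_scope.
Variable R : realType.
Local Notation K := (R[i] : numFieldType).

(** A ball is star-shaped about its centre, and the derivative along [u - u0] is a combination of
    the partial ones. *)
Lemma partials0_near_const r m n (f : 'rV[K]_r -> 'M[K]_(m, n))
  (O : set 'rV[K]_r) u0 :
  open O -> O u0 -> (forall u, O u -> differentiable f u) ->
  (forall u p, O u -> partial p f u = 0) -> \forall u \near u0, f u = f u0.
Proof.
move=> oO Ou df pf.
have /nbhs_ballP [e e0 eO] : nbhs u0 O by exact: open_nbhs_nbhs.
apply/nbhs_ballP; exists e => // u.
rewrite -ball_normE /= distrC => ue; apply/matrixP => i j.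
rewrite -[u in LHS](subrKC u0); apply: (@derive0_const_segment R _
  (fun y => f y i j)) => t /andP[t0 t1].
have Ot : O (u0 + t%:C *: (u - u0)).
  apply: eO; rewrite -ball_normE /= opprD addNKr normrN normrZ.
  apply: le_lt_trans ue; rewrite -[leRHS]mul1r ler_wpM2r //.
  by rewrite ger0_norm ?ler0c // lecR.
have dft := df _ Ot.
apply: DeriveDef; first by apply: diff_derivable;
  exact: differentiable_mx_entry.
rewrite -derive_mx_entry // derive_partials // summxE big1 // => p _.
by have := pf _ p Ot; rewrite /partial => ->; rewrite scaler0 mxE.
Qed.

(* Normalize A to [At = (A *m B)^-1 *m A] with B constant, so that [At *m B = 1]
   and the column of index 0 of At is constant.  A point of the generator at
   infinity is s *m At with s constant; its derivative lies in A and is killed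
   by B, hence vanishes. *)
Lemma infinity_part_near_const r k N (A : 'rV[K]_r -> 'M[K]_(k, N.+1))
  (U : set 'rV[K]_r) u0 :
  open U -> U u0 -> holomorphic U A -> row_free (A u0) ->
  (exists s, ~ at_infinity (s *m A u0)) ->
  (forall u s p, U u -> at_infinity (s *m A u) ->
    (s *m partial p A u <= A u)%MS) ->
  \forall u \near u0, (infinity_part (A u) == infinity_part (A u0))%MS.
Proof.
move=> oU Uu0 hA rf [s0 s0inf] stab.
set h0 := col 0 (A u0).
have [B' B'E] := row_freeP rf.
have [v vh] : exists v : 'rV[K]_k, v *m h0 = 1%:M.
  have c0 : (s0 *m A u0) 0 0 != 0 by apply/eqP.
  exists (((s0 *m A u0) 0 0)^-1 *: s0).
  rewrite -scalemxAl /h0 colE mulmxA -colE; apply/matrixP => i j.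
  by rewrite !ord1 !mxE mulVf //; move: c0; rewrite mxE.
pose e0 : 'cV[K]_N.+1 := delta_mx 0 0.
have Ae0 u : A u *m e0 = col 0 (A u) by rewrite colE.
(* A right inverse [B'] of [A u0] is corrected by a rank-one term that [A u0] kills; [B *m h0 = e0]
   then forces the column of index 0 of [At] to be constantly [h0]. *)
have [B [AB Bh]] : exists B, A u0 *m B = 1%:M /\ B *m h0 = e0.
  exists (B' + (e0 - B' *m h0) *m v); split.
    by rewrite mulmxDr mulmxA mulmxBr mulmxA B'E mul1mx Ae0 subrr mul0mx addr0.
  by rewrite mulmxDl -[_ *m v *m _]mulmxA vh mulmx1 addrC subrK.
pose g u := A u *m B.
have hg : holomorphic U g by apply: holomorphic_mulmx => //;
  exact: holomorphic_cst.
pose W := U `&` [set u | g u \in unitmx].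
have nW : nbhs u0 W.
  apply: filterI; first exact: open_nbhs_nbhs.
  have dg : differentiable (fun u => \det (g u)) u0.
    apply: (@smooth_differentiable _ _ 0%N U) => //; apply: smooth_det => //.
    by move=> i j; exact: (proj1 (holomorphicP _ oU) hg).
  have gu0 : \det (g u0) != 0 by rewrite /g AB det1 oner_neq0.
  apply: filterS (cvgr_neq0 _ (differentiable_continuous dg) gu0) => u.
  by rewrite /= unitmxE unitfE.
pose O := interior W.
have oO : open O by exact: open_interior.
have Ou0 : O u0 by exact: nbhs_singleton (nbhs_interior nW).
have OU : O `<=` U by move=> u /interior_subset [].
have gO u : O u -> g u \in unitmx by move=> /interior_subset [].
pose X u := invmx (g u).
have dX u : O u -> differentiable X u.
  by apply: holomorphic_differentiable; apply: holomorphic_invmx => //;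
    exact: holomorphic_subset OU hg.
have dA u : O u -> differentiable A u.
  by move=> /OU; exact: holomorphic_differentiable.
pose At u := X u *m A u.
have dAt u : O u -> differentiable At u.
  by move=> Ou; apply: differentiable_mulmx; [exact: dX|exact: dA].
have Ate0 u : O u -> At u *m e0 = h0.
  by move=> Ou; rewrite /At -Bh -mulmxA (mulmxA (A u)) mulKmx //; exact: gO.
pose F u := kermx h0 *m At u.
have dF u : O u -> differentiable F u by move=> Ou;
  apply: differentiable_mulmxl; exact: dAt.
have pF u p : O u -> partial p F u = 0.
  move=> Ou; have EF : partial p F u = kermx h0 *m partial p At u.
    by rewrite /partial derive_mulmxl //; exact: dAt.
  have FB : partial p F u *m B = 0.
    rewrite /partial -derive_mulmxr; last exact: dF.
    rewrite (derive_congr_open (g := fun=> kermx h0) _ oO Ou) ?derive_cst //.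
    by move=> y Oy; rewrite /F /At -!mulmxA mulVmx ?mulmx1 //; exact: gO.
  have : (partial p F u <= A u)%MS.
    rewrite EF /partial (derive_mulmx _ (dX _ Ou) (dA _ Ou)) mulmxDr;
      apply: addmx_sub.
      by rewrite mulmxA submxMl.
    rewrite mulmxA; apply/row_subP => i; rewrite row_mul; apply: stab;
      first exact: OU.
    apply/at_infinity_col; rewrite -Ae0 -row_mul -mulmxA (mulmxA (X u))
      -/(At u).
    by rewrite Ate0 // mulmx_ker row0.
  move=> /submxP [z Ez]; move: FB; rewrite Ez -mulmxA -/(g u) => zg.
  by rewrite -[z](mulmxK (gO _ Ou)) zg !mul0mx.
have FE u : O u -> (F u == infinity_part (A u))%MS.
  move=> Ou; apply/andP; split.
    apply/infinity_partP; split; first by rewrite /F /At mulmxA submxMl.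
    by rewrite colE /F -mulmxA Ate0 // mulmx_ker.
  rewrite /infinity_part; have -> : A u = g u *m At u by rewrite /At mulKVmx //;
    exact: gO.
  rewrite mulmxA /F; apply: submxMr; apply/sub_kermxP.
  have E : g u *m h0 = col 0 (g u *m At u) by rewrite colE -[RHS]mulmxA -/e0
    Ate0.
  by rewrite -mulmxA E mulmx_ker.
have := partials0_near_const oO Ou0 dF pF.
have nO : nbhs u0 O by exact: open_nbhs_nbhs.
move: nO; apply: filterS2 => u Ou Fu.
have /eqmxP e1 := FE _ Ou; have /eqmxP e2 := FE _ Ou0.
by apply/eqmxP; apply: eqmx_trans (eqmx_sym e1) _; rewrite Fu.
Qed.
End Constancy.

(** * Rank of the Gauss map *)

Section GaussRank.
Variables (K : numFieldType) (r k N : nat) (A : 'rV[K]_r -> 'M[K]_(k, N.+1)).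

Let G (z : 'rV[K]_(k + r)) := tangent A (rsubmx z) (lsubmx z).

(** The two difference quotients are the same function. *)
Lemma derive_comp_linear (V W X : normedModType K) (L : {linear V -> W})
  (f : W -> X) z v :
  'D_v (f \o L) z = 'D_(L v) f (L z).
Proof.
rewrite /derive; set F1 := fun h => _; set F2 := fun h => _.
by suff -> : F1 = F2 by []; apply/funext => h; rewrite /F1 /F2 /= (linearP L).
Qed.

Lemma derive_tangent (u : 'rV[K]_r) (s : 'rV[K]_k) (sg : 'rV[K]_k)
  (w : 'rV[K]_r) :
  differentiable A u -> (forall p, differentiable (partial p A) u) ->
  differentiable G (row_mx s u) /\
  'D_(row_mx sg w) G (row_mx s u) =
    col_mx ('D_w A u) (\matrix_(p < r) (sg *m partial p A u + s *m 'D_w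
      (partial p A) u)).
Proof.
move=> dA dP.
set z0 := row_mx s u; set v0 := row_mx sg w.
have rz : rsubmx z0 = u by rewrite row_mxKr.
have lz : lsubmx z0 = s by rewrite row_mxKl.
have dl : differentiable (lsubmx : 'rV[K]_(k + r) -> 'rV[K]_k) z0
  by exact: differentiable_lsubmx.
have dr : differentiable (rsubmx : 'rV[K]_(k + r) -> 'rV[K]_r) z0
  by exact: differentiable_rsubmx.
have dAr : differentiable (A \o rsubmx) z0 by apply: differentiable_comp => //;
  rewrite rz.
have dPr p : differentiable (partial p A \o rsubmx) z0
  by apply: differentiable_comp => //; rewrite rz.
have dlP p : differentiable (fun z : 'rV[K]_(k + r) => lsubmx z *m
  (partial p A \o rsubmx) z) z0.
  exact: differentiable_mulmx.
have Gl i j : (fun z => G z (lshift r i) j) = (fun z => (A \o rsubmx) z i j).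
  by apply/funext => z; rewrite /G /tangent col_mxEu.
have Gr p j : (fun z => G z (rshift k p) j)
  = (fun z => (lsubmx z *m (partial p A \o rsubmx) z) 0 j).
  by apply/funext => z; rewrite /G /tangent col_mxEd mxE.
have dG : differentiable G z0.
  apply: differentiable_mx => i j; case: (split_ordP i) => i' ->.
    by rewrite Gl; exact: differentiable_mx_entry.
  by rewrite Gr; exact: differentiable_mx_entry.
split => //; apply/matrixP => i j; rewrite derive_mx_entry //.
case: (split_ordP i) => i' ->.
  rewrite Gl -derive_mx_entry // col_mxEu.
  by rewrite (derive_comp_linear rsubmx) /= /v0 /z0 !row_mxKr.
rewrite Gr -derive_mx_entry // col_mxEd mxE (derive_mulmx _ dl (dPr i')).
rewrite (derive_comp_linear rsubmx) /= /v0 /z0 !row_mxKr !row_mxKl.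
have -> : 'D_(row_mx sg w) (lsubmx : 'rV[K]_(k + r) -> 'rV[K]_k) (row_mx s u)
  = sg.
  have := @derive_comp_linear 'rV[K]_(k + r) _ _
    (lsubmx : {linear 'rV[K]_(k + r) -> 'rV[K]_k}) id (row_mx s u)
    (row_mx sg w).
  by rewrite /= derive_id row_mxKl.
by [].
Qed.

(** Directions along the generator do not move the tangent space, so the upper block of the
    differential is 0. The rank is that of the [r] remaining rows, and it equals [r] exactly when no
    nonzero [w] is killed. *)
Lemma gauss_rankP (u : 'rV[K]_r) (s : 'rV[K]_k) :
  differentiable A u -> (forall p, differentiable (partial p A) u) ->
  (forall p, (partial p A u <= tangent A u s)%MS) ->
  gauss_rank A u s = r <->
  forall w : 'rV[K]_r, (forall p, (s *m 'D_w (partial p A) u <= tangent A u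
    s)%MS) -> w = 0.
Proof.
move=> dA dP PT.
have dG : differentiable G (row_mx s u) by have [] := derive_tangent s 0 0 dA
  dP.
rewrite /gauss_rank /grassmann_rank -/G row_mxKl row_mxKr.
set L := lin1_mx _; set T := tangent A u s.
(* [lin1_mx] records only the values on basis vectors; differentiability of [G] extends the formula
   to every [v]. *)
have LE v : v *m L = mxvec ('D_v G (row_mx s u) *m cokermx T).
  rewrite derive_partials // {1}[v]row_sum_delta !mulmx_suml linear_sum;
    apply: eq_bigr => i _.
  rewrite -!scalemxAl linearZ_LR /= -rowE; congr (_ *: _).
  by apply/rowP => j; rewrite [LHS]mxE [LHS]mxE.
have L0 w : w *m L = 0 <-> ('D_w G (row_mx s u) <= T)%MS.
  rewrite LE submxE; split=> [/eqP|/eqP ->]; last by rewrite linear0.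
  by rewrite mxvec_eq0.
have DT sg w : ('D_(row_mx sg w) G (row_mx s u) <= T)%MS <->
    forall p, (s *m 'D_w (partial p A) u <= T)%MS.
  have [_ ->] := derive_tangent s sg w dA dP.
  have DA : ('D_w A u <= T)%MS.
    rewrite (_ : 'D_w A u = \sum_p w 0 p *: partial p A u).
      by apply: summx_sub => p _; apply: scalemx_sub; exact: PT.
    exact: derive_partials.
  have sP p : (sg *m partial p A u <= T)%MS by apply: submx_trans (submxMl _ _)
    (PT p).
  split=> [|H].
    rewrite col_mx_sub => /andP [_ /row_subP H] p; have := H p; rewrite rowK =>
      Hp.
    by rewrite -[_ *m _](addKr (sg *m partial p A u)) addmx_sub // eqmx_opp.
  rewrite col_mx_sub DA /=; apply/row_subP => p; rewrite rowK.
  by apply: addmx_sub; [exact: sP|exact: H].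
have LU : usubmx L = 0.
  apply/row_matrixP => i; rewrite row_usubmx row0 rowE; apply/L0.
  have -> : delta_mx 0 (lshift r i) = row_mx (delta_mx 0 i) 0 :> 'rV[K]_(k + r).
    apply/rowP => j; rewrite !mxE; case: (split_ordP j) => j' ->.
      by rewrite mxE (inj_eq (@lshift_inj _ _)).
    by rewrite mxE eq_rlshift.
  apply/DT => p; have -> : 'D_0 (partial p A) u = 0 by exact: derive0.
  by rewrite mulmx0 sub0mx.
have LD w : w *m dsubmx L = row_mx 0 w *m L.
  by rewrite -{2}[L]vsubmxK LU mul_row_col mul0mx add0r.
have -> : \rank L = \rank (dsubmx L).
  by rewrite -{1}[L]vsubmxK LU rank_col_0mx.
split=> [rk w Hw|H].
  have : row_free (dsubmx L) by rewrite /row_free rk.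
  rewrite -kermx_eq0 => /rowV0P; apply; apply/sub_kermxP.
  by rewrite LD; apply/L0/DT.
apply/eqP; rewrite -/(row_free _) -kermx_eq0; apply/rowV0P => w /sub_kermxP wL.
by apply: H; apply/(DT 0)/L0; rewrite -LD.
Qed.
End GaussRank.

(** * Affine sections of parallel generators *)

Lemma connected_locally_constant (T : topologicalType) (X : Type) (F : T -> X) :
  connected [set: T] -> (forall x, \forall y \near x, F y = F x) -> forall x y,
    F x = F y.
Proof.
move=> cT lc x y; pose B := [set z | F z = F x].
have BE : B = [set: T].
  apply: cT; first by exists x.
    exists B; last by rewrite setTI.
    rewrite openE => z Bz; rewrite /interior; have := lc z; apply: filterS => w.
    by rewrite /B /= => ->.
  exists B; last by rewrite setTI.
  rewrite -openC openE => z Bz; rewrite /interior; have := lc z;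
    apply: filterS => w.
  by rewrite /B /= => Ew Fw; apply: Bz; rewrite /B /= -Ew.
by have : B y by rewrite BE.
Qed.

Lemma near_chart (K : numFieldType) (M : topologicalType) r (c : chart K M r) m
    (P : 'rV[K]_r -> Prop) : is_chart c -> chart_dom c m ->
  (\forall u \near chart_map c m, P u) ->
  \forall m' \near m, chart_dom c m' /\ P (chart_map c m').
Proof.
move=> [[od _] cm _ _] dm nP.
have cm' : {in chart_dom c, continuous (chart_map c)}.
  by move: cm; rewrite continuous_open_subspace.
apply: filterI; first exact: open_nbhs_nbhs.
exact: (cm' m (mem_set dm) _ nP).
Qed.

Section DirectionProjection.
Variables (F : fieldType) (l N : nat) (B : 'M[F]_(l, N.+1)).

(** The projection along the row space of [B] onto a complement that depends on [B] only, hence the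
    same for all generators. *)
Definition direction_proj : 'M[F]_N.+1 := 1%:M - pinvmx B *m B.

Lemma direction_proj0 m (x : 'M[F]_(m, N.+1)) : (x <= B)%MS ->
  x *m direction_proj = 0.
Proof. by move=> xB; rewrite mulmxBr mulmx1 mulmxA mulmxKpV // subrr. Qed.

Lemma direction_proj_sub m (x : 'M[F]_(m, N.+1)) :
  (x - x *m direction_proj <= B)%MS.
Proof. by rewrite mulmxBr mulmx1 opprB addrCA subrr addr0 mulmxA submxMl. Qed.
End DirectionProjection.

Lemma homogE (K : numFieldType) N (y : 'rV[K]_N.+1) : y 0 0 = 1 ->
  y = homog (@rsubmx K 1 1 N y).
Proof.
move=> y0; rewrite /homog (_ : 1%:M = @lsubmx K 1 1 N y); first exact: esym
  (@hsubmxK K 1 1 N y).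
by apply/matrixP => i j; rewrite !ord1 !mxE eqxx -y0; congr (y _ _);
  exact: val_inj.
Qed.

Lemma homog0 (K : numFieldType) N (x : 'rV[K]_N) : homog x 0 0 = 1.
Proof.
transitivity (row_mx (1%:M : 'M[K]_1) x 0 (lshift N 0));
  last by rewrite row_mxEl mxE eqxx.
by rewrite /homog; congr (fun_of_matrix _ _ _); apply: val_inj.
Qed.

(** Two affine points of a generator differ by a vector at infinity, that is, in [B]; the projection
    thus collapses the affine part of the generator to one point, which still lies on it. *)
Lemma affine_section (K : numFieldType) k l N (A : 'M[K]_(k, N.+1))
  (B : 'M[K]_(l, N.+1)) :
  (infinity_part A :=: B)%MS -> (exists s, ~ at_infinity (s *m A)) ->
  exists b : 'rV[K]_N, (homog b <= A)%MS /\ A *m direction_proj B = col 0 A *m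
    homog b.
Proof.
move=> AB [s sA]; set P := direction_proj B.
have BA : (B <= A)%MS by rewrite -AB; have [] :=
  (infinity_partP A (infinity_part A)).1 (submx_refl _).
have B0 : col 0 B = 0.
  have : (B <= infinity_part A)%MS by rewrite AB.
  by move=> /infinity_partP [].
have P0 m (x : 'M[K]_(m, N.+1)) : col 0 (x *m P) = col 0 x.
  have /submxP [D ED] := direction_proj_sub B x.
  have := congr1 (col 0) ED; rewrite !colE mulmxBl -mulmxA -(colE 0 B) B0
    mulmx0.
  by move=> /eqP; rewrite subr_eq0 => /eqP <-.
have PA m (x : 'M[K]_(m, N.+1)) : (x <= A)%MS -> (x *m P <= A)%MS.
  move=> xA; rewrite -[_ *m P](subKr x) addmx_sub // eqmx_opp.
  by apply: submx_trans BA; exact: direction_proj_sub.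
pose y := ((s *m A) 0 0)^-1 *: (s *m A).
have sA0 : (s *m A) 0 0 != 0 by apply/eqP.
have yA : (y <= A)%MS by apply: scalemx_sub; exact: submxMl.
have y0 : y 0 0 = 1 by rewrite mxE mulVf.
have colP m (x : 'M[K]_(m, N.+1)) : forall i, (col 0 x) i 0 = x i 0 by move=> i;
  rewrite mxE.
have yP0 : (y *m P) 0 0 = 1 by rewrite -colP P0 colP.
exists (@rsubmx K 1 1 N (y *m P)); rewrite -homogE //; split; first exact: PA.
(* Subtracting from each row its coordinate of index 0 times the normalized point [y] leaves vectors
   at infinity. *)
have : (A - col 0 A *m y <= B)%MS.
  rewrite -AB; apply/infinity_partP; split.
    by apply: addmx_sub => //; rewrite eqmx_opp; apply: submx_trans yA;
      exact: submxMl.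
  have cy : col 0 y = 1%:M by apply/matrixP => i j; rewrite !ord1 colP y0 mxE.
  have cAy : col 0 (col 0 A *m y) = col 0 A by rewrite (colE 0 (_ *m _)) -mulmxA
    -colE cy mulmx1.
  by rewrite colE mulmxBl -(colE 0 (_ *m _)) cAy -colE subrr.
move=> /(direction_proj0 (B := B)); rewrite mulmxBl => /eqP; rewrite subr_eq0 =>
  /eqP ->.
by rewrite mulmxA.
Qed.

Lemma row_basis_of_rank (F : fieldType) m n l (S : 'M[F]_(m, n)) : \rank S = l
  ->
  exists B : 'M[F]_(l, n), (B :=: S)%MS /\ row_free B.
Proof.
by move=> <-; exists (row_base S); split;
  [exact: eq_row_base|exact: row_base_free].
Qed.

Lemma rank_infinity_part (K : numFieldType) l N (A : 'M[K]_(l.+1, N.+1)) :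
  row_free A ->
  (exists s, ~ at_infinity (s *m A)) -> \rank (infinity_part A) = l.
Proof.
move=> rA [s sA]; rewrite /infinity_part mxrankMfree // mxrank_ker.
suff -> : \rank (col 0 A) = 1%N by rewrite subn1.
apply/eqP; rewrite eqn_leq rank_leq_col lt0n mxrank_eq0; apply/eqP => h.
by apply: sA; apply/at_infinity_col; rewrite h mulmx0.
Qed.

(* The relation AP is division free; its first and second derivatives compare
   those of the lift A, modulo A, with those of the affine section b. *)
Section AffineSection.
Variables (K : numFieldType) (r k l N : nat).
Variables (A : 'rV[K]_r -> 'M[K]_(k, N.+1)) (B : 'M[K]_(l, N.+1)).
Variables (b : 'rV[K]_r -> 'rV[K]_N) (U : set 'rV[K]_r).
Hypotheses (oU : open U) (hA : holomorphic U A).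
Let P := direction_proj B.
Let bt u := homog (b u).
Hypothesis AP : forall u, U u -> A u *m P = col 0 (A u) *m bt u.

(** With [s] fixed, [bt u] is [s *m A u *m P] divided by the scalar [(s *m A u) 0 0], which stays
    nonzero near [u0]. *)
Lemma section_smooth u0 : U u0 -> (exists s, ~ at_infinity (s *m A u0)) ->
  exists2 V : set 'rV[K]_r, V u0 & forall d j, smooth_upto d V
    (fun u => bt u 0 j).
Proof.
move=> Uu0 [s s0].
have hsA : holomorphic U (fun u => s *m A u).
  by apply: holomorphic_mulmx => //; exact: holomorphic_cst.
have sm d j : smooth_upto d U (fun u => (s *m A u) 0 j)
  by exact: (proj1 (holomorphicP _ oU) hsA).
have smP d j : smooth_upto d U (fun u => (s *m A u *m P) 0 j).
  apply: (proj1 (holomorphicP (fun u => s *m A u *m P) oU)).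
  by apply: holomorphic_mulmx => //; exact: holomorphic_cst.
pose W := U `&` [set u | (s *m A u) 0 0 != 0].
have nW : nbhs u0 W.
  apply: filterI; first exact: open_nbhs_nbhs.
  have d0 := smooth_differentiable (sm 0%N 0) Uu0.
  apply: (cvgr_neq0 _ (differentiable_continuous d0)); exact/eqP.
have oO : open (interior W) by exact: open_interior.
have OU : interior W `<=` U by move=> u /interior_subset [].
exists (interior W); first exact: nbhs_singleton (nbhs_interior nW).
move=> d j.
have := smooth_mul oO (smooth_inv oO _ (smooth_subset OU (sm d 0)))
  (smooth_subset OU (smP d j)).
have H0 u : interior W u -> (s *m A u) 0 0 != 0 by move=> /interior_subset [].
move=> /(_ H0); apply: smooth_ext => // u Ou.
have -> : s *m A u *m P = (s *m A u) 0 0 *: bt u.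
  rewrite -mulmxA (AP (OU _ Ou)) mulmxA colE mulmxA -colE.
  rewrite (_ : col 0 (s *m A u) = ((s *m A u) 0 0)%:M) ?mul_scalar_mx //.
  by apply/matrixP => i i'; rewrite !ord1 [LHS]mxE [RHS]mxE eqxx.
by rewrite [X in _ * X]mxE mulrA mulVf ?mul1r //; exact: H0.
Qed.

Hypothesis hbt : holomorphic U bt.
Variables (u : 'rV[K]_r) (s : 'rV[K]_k).
Hypotheses (Uu : U u) (sinf : ~ at_infinity (s *m A u)).
Hypotheses (rfT : row_free (tangent A u s)) (reg : regular_point A u s).
Hypotheses (BA : (B <= A u)%MS) (btA : (bt u <= A u)%MS).

Let e0 : 'cV[K]_N.+1 := delta_mx 0 0.
Let al := (s *m A u) 0 0.

Let al0 : al != 0. Proof. exact/eqP. Qed.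

Let dA v : U v -> differentiable A v. Proof.
  exact: holomorphic_differentiable. Qed.
Let dbt v : U v -> differentiable bt v. Proof.
  exact: holomorphic_differentiable. Qed.
Let dPA p v : U v -> differentiable (partial p A) v.
Proof. by apply: holomorphic_differentiable; exact: holomorphic_partial. Qed.
Let dPbt p v : U v -> differentiable (partial p bt) v.
Proof. by apply: holomorphic_differentiable; exact: holomorphic_partial. Qed.

Let AP' v : U v -> A v *m P = A v *m e0 *m bt v.
Proof. by move=> Uv; rewrite AP // colE. Qed.

Let DAP v w : U v -> 'D_w A v *m P = 'D_w A v *m e0 *m bt v + A v *m e0 *m 'D_w
  bt v.
Proof.
move=> Uv; rewrite -derive_mulmxr; last exact: dA.
rewrite (derive_congr_open _ oU Uv AP') (derive_mulmx _ _ (dbt Uv)).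
  by rewrite derive_mulmxr //; exact: dA.
by apply: differentiable_mulmxr; exact: dA.
Qed.

Let DDAP p w : 'D_w (partial p A) u *m P =
  'D_w (partial p A) u *m e0 *m bt u + partial p A u *m e0 *m 'D_w bt u
  + ('D_w A u *m e0 *m partial p bt u + A u *m e0 *m 'D_w (partial p bt) u).
Proof.
rewrite -derive_mulmxr; last exact: dPA.
have d1 : differentiable (fun v => partial p A v *m e0) u
  by apply: differentiable_mulmxr; exact: dPA.
have d2 : differentiable (fun v => A v *m e0) u by apply: differentiable_mulmxr;
  exact: dA.
have d3 : differentiable (fun v => partial p A v *m e0 *m bt v) u.
  by apply: differentiable_mulmx => //; exact: dbt.
have d4 : differentiable (fun v => A v *m e0 *m partial p bt v) u.
  by apply: differentiable_mulmx => //; exact: dPbt.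
have E : 'D_w (fun v => partial p A v *m P) u =
    'D_w ((fun v => partial p A v *m e0 *m bt v) + (fun v => A v *m e0 *m
      partial p bt v)) u.
  by apply: (derive_congr_open _ oU Uu) => v Uv; exact: DAP.
apply: etrans E _.
rewrite deriveD; [|exact: diff_derivable|exact: diff_derivable].
rewrite (derive_mulmx w d1 (dbt Uu)) (derive_mulmx w d2 (dPbt p Uu)).
by rewrite (derive_mulmxr _ _ (dPA p Uu)) (derive_mulmxr _ _ (dA Uu)).
Qed.

Let salpha : s *m (A u *m e0) = al%:M.
Proof.
by apply/matrixP => i j; rewrite mulmxA -colE !ord1 [LHS]mxE [RHS]mxE eqxx.
Qed.

Let sDAP p : s *m partial p A u *m P = (s *m partial p A u *m e0) *m bt u + al
  *: partial p bt u.
Proof.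
have E := DAP (delta_mx 0 p) Uu.
rewrite -mulmxA; apply: etrans (congr1 (mulmx s) E) _.
by rewrite mulmxDr !mulmxA -(mulmxA s (A u)) salpha mul_scalar_mx.
Qed.

Let subA m (x : 'M[K]_(m, N.+1)) : (x *m P <= A u)%MS -> (x <= A u)%MS.
Proof.
move=> xP; rewrite -[x](subrK (x *m P)) addmx_sub //.
by apply: submx_trans BA; exact: direction_proj_sub.
Qed.

Let subT m (x : 'M[K]_(m, N.+1)) : (x *m P <= tangent A u s)%MS ->
  (x <= tangent A u s)%MS.
Proof.
move=> xP; rewrite -[x](subrK (x *m P)) addmx_sub //.
apply: submx_trans (direction_proj_sub _ _) _; apply: submx_trans BA _.
by rewrite /tangent -addsmxE addsmxSl.
Qed.

(** Modulo [A u], the projected displacements of [s] are [al] times the derivatives of [bt], and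
    membership in [A u] can be tested after projecting since [B] lies in it. Independence modulo the
    generator, not just of the derivatives, is what later includes the vectors [a j]. *)
Lemma section_independent (w : 'rV[K]_r) :
  ((\sum_p w 0 p *: partial p bt u)%R <= A u)%MS -> w = 0.
Proof.
move=> H.
have : (w *m (\matrix_(p < r) (s *m partial p A u)) <= A u)%MS.
  pose C p : 'M[K]_1 := w 0 p *: (s *m partial p A u *m e0).
  have E p : (w 0 p *: row p (\matrix_(p < r) (s *m partial p A u))) *m P =
      C p *m bt u + al *: (w 0 p *: partial p bt u).
    by rewrite rowK -scalemxAl sDAP scalerDr -scalemxAl !scalerA (mulrC al).
  apply: subA; rewrite (mulmx_sum_row w) mulmx_suml
    (eq_bigr _ (fun p _ => E p)).
  rewrite big_split /= -mulmx_suml -scaler_sumr addmx_sub ?scalemx_sub //.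
  by apply: submx_trans btA; exact: submxMl.
move=> /submxP [z Ez].
have := rfT; rewrite -kermx_eq0 => /rowV0P /(_ (row_mx (- z) w)) H0.
suff /H0 : (row_mx (- z) w <= kermx (tangent A u s))%MS by rewrite -row_mx0 =>
  /eq_row_mx [].
by apply/sub_kermxP; rewrite /tangent mul_row_col Ez mulNmx addNr.
Qed.

(** By [DDAP], the second derivatives of [s *m A] after projection and [al] times those of [bt]
    agree modulo the tangent space of the submanifold, which contains that of the section. A
    direction killed by the Gauss map of the section is thus killed by the one of the
    submanifold. *)
Lemma section_gauss_rank : gauss_rank A u s = r -> gauss_rank bt u
  (1%:M : 'rV[K]_1) = r.
Proof.
have TA : (A u <= tangent A u s)%MS by rewrite /tangent -addsmxE addsmxSl.
have Tp p : (partial p A u <= tangent A u s)%MS.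
  have /eqmxP -> := reg; rewrite /tangent_along; apply: submx_trans
    (addsmxSr _ _).
  by apply: (sumsmx_sup p) => //; rewrite genmxE.
have Tbp p : (partial p bt u <= tangent bt u 1%:M)%MS.
  rewrite /tangent -addsmxE; apply: submx_trans (addsmxSr _ _).
  rewrite -[X in (X <= _)%MS]mul1mx.
  have E := rowK (fun q => (1%:M : 'M[K]_1) *m partial q bt u) p.
  by apply: submx_trans (row_sub p _); rewrite E.
move=> /(gauss_rankP (dA Uu) (fun p => dPA p Uu) Tp) H.
apply/(gauss_rankP (dbt Uu) (fun p => dPbt p Uu) Tbp) => w Hw; apply: H => p.
have bpT q : (partial q bt u <= tangent A u s)%MS.
  have : (s *m partial q A u *m P <= tangent A u s)%MS.
    rewrite -[_ *m P](subKr (s *m partial q A u)) addmx_sub //.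
      by apply: submx_trans (submxMl _ _) (Tp q).
    rewrite eqmx_opp; apply: submx_trans (direction_proj_sub _ _) _.
    exact: submx_trans BA TA.
  rewrite sDAP => H1.
  rewrite -(scalerK al0 (partial q bt u)) scalemx_sub //.
  rewrite -[_ *: _](addKr (s *m partial q A u *m e0 *m bt u))
    addmx_sub // eqmx_opp.
  by apply: submx_trans (submxMl _ _) _; exact: submx_trans btA TA.
have DbT v : ('D_v bt u <= tangent A u s)%MS.
  rewrite (derive_partials _ (dbt Uu)); apply: summx_sub => q _;
    apply: scalemx_sub.
  exact: bpT.
have TbT : (tangent bt u 1%:M <= tangent A u s)%MS.
  rewrite {1}/tangent col_mx_sub (submx_trans btA TA) /=.
  by apply/row_subP => q; rewrite rowK mul1mx; exact: bpT.
apply: subT; rewrite -mulmxA DDAP !mulmxDr !mulmxA.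
have sub3 m (x : 'M[K]_(1, m)) (y : 'M[K]_(m, N.+1)) : (y <= tangent A u s)%MS
  -> (x *m y <= tangent A u s)%MS.
  by move=> yT; apply: submx_trans (submxMl _ _) yT.
have btT := submx_trans btA TA.
apply: addmx_sub; apply: addmx_sub.
- exact: sub3.
- by apply: sub3; exact: DbT.
- by apply: sub3; exact: bpT.
rewrite -(mulmxA s (A u)) salpha mul_scalar_mx scalemx_sub //.
by have := Hw p; rewrite mul1mx => /submx_trans; apply.
Qed.

End AffineSection.

(** * The cylinder *)

Lemma homog_rshift (K : numFieldType) N (x : 'rV[K]_N) j : homog x
  0 (rshift 1 j) = x 0 j.
Proof. exact: (@row_mxEr K 1 1 N). Qed.

Lemma homog_lshift (K : numFieldType) N (x : 'rV[K]_N) (j : 'I_1) : homog x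
  0 (lshift N j) = 1.
Proof.
apply: etrans (@row_mxEl K 1 1 N 1%:M x 0 j) _.
by rewrite ord1 mxE.
Qed.

Lemma homog_sub (K : numFieldType) N (x y : 'rV[K]_N) :
  homog x - homog y = row_mx (0 : 'M_1) (x - y).
Proof.
apply/matrixP => i j; rewrite ord1 [LHS]mxE [X in _ + X]mxE.
(* The index type is restated as ['I_(1 + N)] so that [split_ordP] can separate the coordinate of
   index 0. *)
have : forall j : 'I_(1 + N), homog x 0 j - homog y 0 j = row_mx (0 : 'M_1)
  (x - y) 0 j; last exact.
move=> {}j; case: (split_ordP j) => j' ->.
  by rewrite !homog_lshift row_mxEl [RHS]mxE subrr.
by rewrite !homog_rshift row_mxEr [RHS]mxE [X in _ = _ + X]mxE.
Qed.

Lemma partial_homog (K : numFieldType) r N (b : 'rV[K]_r -> 'rV[K]_N) p u :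
  differentiable b u -> differentiable (fun v => homog (b v)) u ->
  partial p (fun v => homog (b v)) u = row_mx (0 : 'M_1) (partial p b u).
Proof.
move=> db dh; apply/matrixP => i j; rewrite ord1 /partial derive_mx_entry //.
have : forall j : 'I_(1 + N), 'D_(delta_mx 0 p) (fun v => homog (b v) 0 j) u =
    row_mx (0 : 'M_1) ('D_(delta_mx 0 p) b u) 0 j; last exact.
move=> {}j; case: (split_ordP j) => j' ->.
  rewrite row_mxEl mxE (_ : (fun v => _) = fun=> 1) ?derive_cst //.
  by apply/funext => v; rewrite homog_lshift.
rewrite row_mxEr derive_mx_entry //.
by congr (derive _ u _); apply/funext => v; rewrite homog_rshift.
Qed.

Section Cylinder.
Variables (R : realType).
Local Notation K := (R[i] : numFieldType).
Variables (N n l r : nat) (M : topologicalType).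
Variables (atlas : set (chart R[i] M r)) (f : M -> 'M[R[i]]_(l.+1, N.+1)).
Hypotheses (hn : n = (l + r)%N) (manifold : complex_manifold atlas).
Hypotheses (connM : connected [set: M]) (compl : complete atlas f).
Hypotheses (smooth : smooth_submanifold n atlas f) (crank : constant_rank atlas
  f).
Hypothesis (pencil : regular_pencil_along_generators n atlas f).

Lemma lift_eqmx (c : chart K M r) U A u : is_lift f c U A -> U u ->
  [/\ (A u :=: f (chart_inv c u))%MS, row_free (A u) & exists s, ~ at_infinity
    (s *m A u)].
Proof.
move=> [_ _ _ /(_ u)] H /H [a a0 ->]; have [rf inf _] := compl.
have e := eqmx_scale (f (chart_inv c u)) a0.
split => //; first by rewrite /row_free e; exact: rf.
have [s sinf] := inf (chart_inv c u); exists s => H'; apply: sinf.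
move: H'; rewrite /at_infinity -scalemxAr mxE => /eqP; rewrite mulf_eq0
  (negPf a0) => /eqP //.
Qed.

Lemma infinity_part_const m m' : (infinity_part (f m) :=: infinity_part
  (f m'))%MS.
Proof.
have [_ _ chartP cover _] := manifold; have [_ _ lifts] := compl.
(* [<<_>>] chooses a canonical matrix for each row space, turning equality of subspaces into
   equality of values. *)
have := @connected_locally_constant M _ (fun m => <<infinity_part (f m)>>%MS)
  connM _ m m'.
move=> H; apply/eqmxP/genmxP; apply: H => {m m'} m.
have [c ac dm] := cover m; have isc := chartP c ac.
have cu : chart_cod c (chart_map c m) by exists m.
have [U [A [lift Uu]]] := lifts c ac _ cu.
have [oU UC hA _] := lift.
have [e rf inf] := lift_eqmx lift Uu.
have near1 : \forall u \near chart_map c m,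
  (infinity_part (A u) == infinity_part (A (chart_map c m)))%MS.
  apply: (infinity_part_near_const oU Uu hA rf inf) => u s p Uu' s0.
  have [rk reg] := smooth ac lift Uu'.
  have [_ _ inf'] := lift_eqmx lift Uu'.
  exact: (lift_infinity_stable hn oU Uu' hA rk reg inf' (pencil ac lift Uu')).
have near2 : \forall u \near chart_map c m, U u by exact: open_nbhs_nbhs.
apply: filterS (near_chart isc dm (filterI near1 near2)) =>
  m' [dm' [/eqmxP Em' Um']].
have [_ _ _ inv] := isc.
have [e' _ _] := lift_eqmx lift Um'.
rewrite inv // in e; rewrite inv // in e'.
apply/genmxP/eqmxP.
apply: eqmx_trans (eqmxP (infinity_part_eqmx (eqmx_sym e'))) _.
by apply: eqmx_trans Em' _; exact/eqmxP/infinity_part_eqmx.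
Qed.

(** The point [m0] supplies the common direction space [B]. Its column of index 0 vanishes, so its
    rows are vectors of the affine space: these are the [a j]. *)
Lemma cylinder_of_point (m0 : M) :
  exists (a : 'I_l -> 'rV[R[i]]_N) (b : M -> 'rV[R[i]]_N),
    [/\ forall m, generator f m =
          [set \sum_(j < l) y 0 j *: a j + b m | y in [set: 'rV[R[i]]_l]],
        affine_part f =
          \bigcup_(c in atlas)
            (cylinder_map a (b \o chart_inv c) @`
               [set y | chart_cod c (rsubmx y)]),
        forall c, atlas c -> holomorphic (chart_cod c) (b \o chart_inv c),
        forall c u, atlas c -> chart_cod c u ->
          cylinder_independent a (b \o chart_inv c) u &
        forall c u, atlas c -> chart_cod c u ->
          tangentially_nondegenerate (b \o chart_inv c) u].
Proof.
have [_ _ chartP cover _] := manifold; have [rf inf lifts] := compl.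
have [B [BE rB]] := row_basis_of_rank (rank_infinity_part (rf m0) (inf m0)).
have fB m : (infinity_part (f m) :=: B)%MS.
  by apply: eqmx_trans (infinity_part_const m m0) _; exact: eqmx_sym.
have Bf m : (B <= f m)%MS.
  by rewrite -(fB m); have [] := (infinity_partP (f m) (infinity_part (f m))).1
    (submx_refl _).
(* Although chosen point by point, [b m] is determined by the projection relation, as [col 0 (f m)]
   is not 0; this is why it turns out holomorphic. *)
have [b bP] := choice (fun m => affine_section (fB m) (inf m)).
pose Am := @rsubmx K l 1 N B.
have BAm : B = row_mx (0 : 'M[K]_(l, 1)) Am.
  have B0 : col 0 B = 0.
    have : (B <= infinity_part (f m0))%MS by rewrite BE.
    by move=> /infinity_partP [].
  rewrite -[LHS](@hsubmxK K l 1 N B); congr (@row_mx K l 1 N _ _).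
  apply/matrixP => i j; rewrite ord1 [RHS]mxE; have /matrixP /(_ i 0) := B0.
  by rewrite !mxE => <-; congr (B _ _); exact: val_inj.
have yB q (y : 'M[K]_(q, l)) : y *m B = row_mx (0 : 'M[K]_(q, 1)) (y *m Am).
  by rewrite {1}BAm; apply: etrans (@mul_mx_row K q l 1 N y 0 Am) _;
    rewrite mulmx0.
pose J : 'M[K]_(N, N.+1) := row_mx (0 : 'M_(N, 1)) 1%:M.
have JE (x : 'rV[K]_N) : row_mx (0 : 'M_1) x = x *m J.
  by apply: esym; apply: etrans (@mul_mx_row K 1 N 1 N x 0 1%:M) _;
    rewrite mulmx0 mulmx1.
pose a j := row j Am.
have aM : \matrix_j a j = Am by apply/row_matrixP => j; rewrite rowK.
have aE (y : 'rV[K]_l) : \sum_(j < l) y 0 j *: a j = y *m Am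
  by rewrite mulmx_sum_row.
exists a, b.
have genE m : generator f m = [set \sum_(j < l) y 0 j *: a j + b m | y in
  [set: 'rV[R[i]]_l]].
  have [bf fP] := bP m.
  apply/seteqP; split => x /=; rewrite /generator /=.
    move=> xf; have xP : homog x *m direction_proj B = homog (b m).
      have [D ED] := submxP xf; rewrite ED -mulmxA fP mulmxA colE mulmxA -ED
        -colE.
      rewrite (_ : col 0 (homog x) = 1%:M) ?mul1mx //.
      by apply/matrixP => i j; rewrite !ord1 mxE homog0 mxE.
    have := direction_proj_sub B (homog x); rewrite xP homog_sub => /submxP [y].
    rewrite yB => /(@eq_row_mx K 1 1 N _ _ _ _) [_ E]; exists y => //.
    by rewrite aE -E subrK.
  move=> [y _ <-]; rewrite aE -[homog _](subrK (homog (b m))) addmx_sub //.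
  rewrite homog_sub addrK; apply: submx_trans (Bf m).
  by apply/submxP; exists y; rewrite yB.
(* The relation is homogeneous in [f m], so it survives the scalar factor of a lift. *)
have liftP (c : chart K M r) U A : is_lift f c U A -> forall u, U u ->
    A u *m direction_proj B = col 0 (A u) *m homog ((b \o chart_inv c) u).
  move=> [_ _ _ H] u /H [x x0 ->]; have [_ E] := bP (chart_inv c u).
  by rewrite -scalemxAl E !colE -!scalemxAl.
have smooth_bt c : atlas c -> forall d j, smooth_upto d (chart_cod c)
  (fun u => homog ((b \o chart_inv c) u) 0 j).
  move=> ac d j; apply: smooth_local => u cu.
  have [U [A [lift Uu]]] := lifts c ac u cu.
  have [oU _ hA _] := lift; have [_ _ infu] := lift_eqmx lift Uu.
  have [V Vu sV] := section_smooth oU hA (liftP c U A lift) Uu infu.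
  by exists V => //; exact: sV.
have ocod c : atlas c -> open (chart_cod c) by move=> /chartP [[]].
have hol_bt c : atlas c -> holomorphic (chart_cod c)
  (fun u => homog ((b \o chart_inv c) u)).
  by move=> ac; apply/holomorphicP => [|d i j]; [exact: ocod|rewrite ord1;
    exact: smooth_bt].
have hol_b c : atlas c -> holomorphic (chart_cod c) (b \o chart_inv c).
  move=> ac; apply/holomorphicP => [|d i j]; first exact: ocod.
  rewrite ord1 (_ : (fun u => _) = (fun u => homog ((b \o chart_inv c) u)
    0 (rshift 1 j))).
    exact: smooth_bt.
  by apply/funext => u; rewrite homog_rshift.
have local c u : atlas c -> chart_cod c u -> exists U A s,
    [/\ [/\ is_lift f c U A, U u, holomorphic U
      (fun u => homog ((b \o chart_inv c) u)) & ~ at_infinity (s *m A u)],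
        row_free (tangent A u s), regular_point A u s, (B <= A u)%MS &
          (homog ((b \o chart_inv c) u) <= A u)%MS].
  move=> ac cu; have [U [A [lift Uu]]] := lifts c ac u cu.
  have [e rfA [s sinf]] := lift_eqmx lift Uu.
  have [_ UC _ _] := lift.
  have [rk reg] := smooth ac lift Uu; have regs := reg s sinf.
  exists U, A, s; split => //.
  - by split => //; exact: holomorphic_subset UC (hol_bt c ac).
  - by have /eqmxP es := regs; rewrite /row_free es rk hn -addSn.
  - by rewrite e.
  - by rewrite e; have [] := bP (chart_inv c u).
split => //.
- apply/seteqP; split => x /=.
    move=> [m _]; rewrite genE => -[y _ <-].
    have [c ac dm] := cover m; exists c => //.
    have [_ _ _ inv] := chartP c ac.
    exists (row_mx y (chart_map c m)); rewrite /= ?row_mxKr; first by exists m.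
    by rewrite /cylinder_map row_mxKl row_mxKr /= inv.
  move=> [c ac [y _ <-]]; exists (chart_inv c (rsubmx y)) => //.
  by rewrite genE; exists (lsubmx y).
- move=> c u ac cu; have [U [A [s [[lift Uu hbU sinf] rT reg BA bA]]]] :=
    local c u ac cu.
  have [oU UC hA _] := lift.
  rewrite /cylinder_independent -kermx_eq0; apply/rowV0P => x /sub_kermxP.
  rewrite -[x]hsubmxK mul_row_col; set v := lsubmx x; set w := rsubmx x => vw.
  have w0 : w = 0.
    apply: (section_independent oU hA (liftP c U A lift) hbU Uu rT BA bA).
    have db : differentiable (b \o chart_inv c) u
      by apply: holomorphic_differentiable (hol_b c ac) cu.
    have dbt : differentiable (fun u => homog ((b \o chart_inv c) u)) u
      by apply: holomorphic_differentiable (hol_bt c ac) cu.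
    have E p : w 0 p *: partial p (fun u => homog ((b \o chart_inv c) u)) u =
        w 0 p *: row_mx (0 : 'M[K]_1) (partial p (b \o chart_inv c) u)
          by rewrite partial_homog.
    apply: submx_trans BA; apply/submxP; exists (- v);
      rewrite (eq_bigr _ (fun p _ => E p)).
    rewrite yB JE mulNmx; have -> : - (v *m Am) = w *m \matrix_(p < r) partial p
      (b \o chart_inv c) u.
      by apply/eqP; rewrite eq_sym -addr_eq0 addrC -aM vw.
    rewrite (mulmx_sum_row w) mulmx_suml; apply: eq_bigr => p _.
    by rewrite rowK JE scalemxAl.
  move: vw; rewrite w0 mul0mx addr0 aM => vAm.
  have vB : v *m B = 0 by rewrite yB vAm JE mul0mx.
  have [B' BB'] := row_freeP rB.
  have -> : v = 0 by rewrite -[v]mulmx1 -BB' mulmxA vB mul0mx.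
  by rewrite row_mx0.
- move=> c u ac cu; have [U [A [s [[lift Uu hbU sinf] rT reg BA bA]]]] :=
    local c u ac cu.
  have [oU UC hA _] := lift.
  apply: (section_gauss_rank oU hA (liftP c U A lift) hbU Uu sinf reg BA bA).
  exact: crank ac lift u Uu s sinf.
Qed.
End Cylinder.

Theorem theorem1 (R : realType) (N n r : nat) (M : topologicalType)
    (atlas : set (chart R[i] M r)) (f : M -> 'M[R[i]]_((n - r).+1, N.+1)) :
  (2 <= r)%N -> (r <= n - 1)%N -> (2 <= N - n)%N ->
  complex_manifold atlas ->
  connected [set: M] ->
  complete atlas f ->
  smooth_submanifold n atlas f ->
  constant_rank atlas f ->
  regular_pencil_along_generators n atlas f ->
  exists (a : 'I_(n - r) -> 'rV[R[i]]_N) (b : M -> 'rV[R[i]]_N),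
    [/\ forall m, generator f m =
          [set \sum_(j < n - r) y 0 j *: a j + b m | y in [set: 'rV[R[i]]_(n - r)]],
        affine_part f =
          \bigcup_(c in atlas)
            (cylinder_map a (b \o chart_inv c) @`
               [set y | chart_cod c (rsubmx y)]),
        forall c, atlas c -> holomorphic (chart_cod c) (b \o chart_inv c),
        forall c u, atlas c -> chart_cod c u ->
          cylinder_independent a (b \o chart_inv c) u &
        forall c u, atlas c -> chart_cod c u ->
          tangentially_nondegenerate (b \o chart_inv c) u].
Proof.
move=> r2 rn _ manifold connM compl smooth crank pencil.
have hn : n = (n - r + r)%N.
  by rewrite subnK // (leq_trans rn) // leq_subr.
(* An empty [M] is connected but offers no generator from which to read the direction space; its
   charts have empty images and every clause is then vacuous. *)
case: (pselect (exists m : M, True)) => [[m0 _]|M0].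
  exact: (cylinder_of_point hn manifold connM compl smooth crank pencil m0).
have noM (m : M) : False by apply: M0; exists m.
have nocod (c : chart R[i] M r) u : chart_cod c u -> False by case=> m; have :=
  noM m.
exists (fun=> 0), (fun=> 0); split.
- by move=> m; have := noM m.
- apply/seteqP; split=> x; first by case=> m; have := noM m.
  by case=> c _ [y /nocod].
- by move=> c _ d; elim: d (_ \o _) => [|d IH] g /=; split=> // u /nocod.
- by move=> c u _ /nocod.
- by move=> c u _ /nocod.
Qed.
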